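(* Let $\{U_i\}$ be an open cover of a smooth manifold $M$, let $\{g_{ijk}\}$ be a $\mathbb{T}$-valued Cech $2$-cocycle, and let $\{A_{ij}\in i\Omega^1(U_{ij})\}$ be 1-forms satisfying $A_{jk}-A_{ik}+A_{ij}=d\log(g_{ijk})$ on triple overlaps. Then there is a 2-term $L_\infty$-algebra $\check V$ with $\check V_0=\mathrm{Ob}(\mathcal{L}_{(g_{ijk},A_{ij})})$ and $\check V_1$ the space of collections $\{u_i:U_i\to i\mathbb{R}\}$ of smooth functions, such that (1) $d:\check V_1\to\check V_0$ is given by $\{u_i\}\mapsto(0,\{u_j-u_i\},\{du_i\})$; (2) on $\check V_0$ the bracket is $$[(\xi,\{f^{\hat\xi}_{ij}\},\{a^{\hat\xi}_i\}),(\eta,\{f^{\hat\eta}_{ij}\},\{a^{\hat\eta}_i\})]=([\xi,\eta],\{\xi(f^{\hat\eta}_{ij})-\eta(f^{\hat\xi}_{ij})\},\{\pounds_\xi a^{\hat\eta}_i-\pounds_\eta a^{\hat\xi}_i\}),$$ and for $\check\xi=(\xi,\{f^{\check\xi}_{ij}\},\{a^{\check\xi}_i\})\in\check V_0$ and $u=\{u_i\}\in\check V_1$, $[\check\xi,u]=\{\xi(u_i)\}=-[u,\check\xi]$; (3) $J=0$.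
   Context: $\mathbb{T}$ is the circle group with Lie algebra $i\mathbb{R}$; $d\log(g)=g^{-1}dg$; $\pounds_\xi$ is the Lie derivative; $U_{ij}=U_i\cap U_j$, etc. A $\mathbb{T}$-valued Cech $2$-cocycle is a collection of smooth $g_{ijk}:U_{ijk}\to\mathbb{T}$ with $g_{jkl}g_{ikl}^{-1}g_{ijl}g_{ijk}^{-1}=1$ on $U_{ijkl}$. Objects of $\mathcal{L}_{(g_{ijk},A_{ij})}$ are triples $(\xi,\{f_{ij}\},\{a_i\})$ with $\xi$ a vector field on $M$, $f_{ij}:U_{ij}\to i\mathbb{R}$ smooth with $f_{jk}-f_{ik}+f_{ij}=\iota_\xi d\log(g_{ijk})$ on $U_{ijk}$, and $a_i\in i\Omega^1(U_i)$ with $a_j-a_i=df_{ij}-\pounds_\xi A_{ij}$ on $U_{ij}$; they form a real vector space with componentwise operations. A 2-term $L_\infty$-algebra is a 2-term chain complex of vector spaces $d:V_1\to V_0$ equipped with an antisymmetric chain map $[\cdot,\cdot]:V\otimes V\to V$ and an antisymmetric chain homotopy $J:V\otimes V\otimes V\to V$ from the chain map $x\otimes y\otimes z\mapsto[x,[y,z]]$ to the chain map $x\otimes y\otimes z\mapsto[[x,y],z]+[y,[x,z]]$, such that for all $x,y,z,w\in V$ $$[x,J(y,z,w)]+J(x,[y,z],w)+J(x,z,[y,w])+[J(x,y,z),w]+[z,J(x,y,w)]$$ $$=J(x,y,[z,w])+J([x,y],z,w)+[y,J(x,z,w)]+J(y,[x,z],w)+J(y,z,[x,w]).$$ Explicitly,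 the bracket being a chain map means $d[x,h]=[x,dh]$ and $[dh,k]=[h,dk]$ for $x\in V_0$, $h,k\in V_1$ (the bracket of two elements of $V_1$ vanishes for degree reasons); antisymmetry means $[x,y]=-[y,x]$. *)

(* Defs.v *)
From HB Require Import structures.
From mathcomp Require Import all_boot all_order all_algebra.
From mathcomp Require Import all_classical all_reals all_analysis.
From mathcomp Require Import ring.
From mathcomp Require Export complex.

Set Implicit Arguments.
Unset Strict Implicit.
Unset Printing Implicit Defensive.

Import Order.TTheory GRing.Theory Num.Theory.
Import numFieldNormedType.Exports.

Local Open Scope classical_set_scope.
Local Open Scope ring_scope.
Local Open Scope complex_scope.

(* 2-term L_oo-algebras on d : V1 -> V0.  The bracket V (x) V -> V is split by
   degree into l_br : V0 V0 -> V0, l_brl : V0 V1 -> V1 and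
   l_brr : V1 V0 -> V1; on V1 V1 it vanishes for degree reasons, and J is
   supported on V0 V0 V0.  The convention for a chain homotopy J from F to G is
   dJ + Jd = G - F. *)
Record linfty2 (R : nzRingType) (V1 V0 : lmodType R) := Linfty2 {
  l_d : V1 -> V0;
  l_br : V0 -> V0 -> V0;
  l_brl : V0 -> V1 -> V1;
  l_brr : V1 -> V0 -> V1;
  l_J : V0 -> V0 -> V0 -> V1;

  l_d_lin : linear l_d;
  l_br_linl : forall y, linear (l_br ^~ y);
  l_br_linr : forall x, linear (l_br x);
  l_brl_linl : forall h, linear (l_brl ^~ h);
  l_brl_linr : forall x, linear (l_brl x);
  l_brr_linl : forall x, linear (l_brr ^~ x);
  l_brr_linr : forall h, linear (l_brr h);
  l_J_lin1 : forall y z, linear (fun x => l_J x y z);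
  l_J_lin2 : forall x z, linear (fun y => l_J x y z);
  l_J_lin3 : forall x y, linear (fun z => l_J x y z);

  l_br_anti : forall x y, l_br x y = - l_br y x;
  l_br_anti1 : forall x h, l_brl x h = - l_brr h x;
  l_br_chain1 : forall x h, l_d (l_brl x h) = l_br x (l_d h);
  l_br_chain2 : forall h k, l_brl (l_d h) k = l_brr h (l_d k);

  l_J_anti12 : forall x y z, l_J x y z = - l_J y x z;
  l_J_anti23 : forall x y z, l_J x y z = - l_J x z y;
  l_J_000 : forall x y z, l_d (l_J x y z) =
    l_br (l_br x y) z + l_br y (l_br x z) - l_br x (l_br y z);
  l_J_100 : forall h y z, l_J (l_d h) y z =
    l_brr (l_brr h y) z + l_brl y (l_brr h z) - l_brr h (l_br y z);
  l_J_010 : forall x h z, l_J x (l_d h) z =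
    l_brr (l_brl x h) z + l_brr h (l_br x z) - l_brl x (l_brr h z);
  l_J_001 : forall x y h, l_J x y (l_d h) =
    l_brl (l_br x y) h + l_brl y (l_brl x h) - l_brl x (l_brl y h);

  l_J_coh : forall x y z w,
    l_brl x (l_J y z w) + l_J x (l_br y z) w + l_J x z (l_br y w)
      + l_brr (l_J x y z) w + l_brl z (l_J x y w)
    = l_J x y (l_br z w) + l_J (l_br x y) z w + l_brl y (l_J x z w)
      + l_J y (l_br x z) w + l_J y z (l_br x w)
}.

Section euclidean_smoothness.
Context {R : realType} {n : nat}.
Implicit Types (O : set 'rV[R]_n) (f g : 'rV[R]_n -> R).

(* f is C^k on the open set O; only the values of f on O matter. *)
Fixpoint Ck (k : nat) O f : Prop :=
  if k is k'.+1 then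
    (forall x, O x -> differentiable f x) /\ (forall v, Ck k' O ('D_v f))
  else forall x, O x -> {for x, continuous f}.

Definition Csmooth O f := forall k, Ck k O f.

Lemma Ck_sub k O O' f : O' `<=` O -> Ck k O f -> Ck k O' f.
Proof.
move=> OO'; elim: k f => [|k IH] f /=; first by move=> + x /OO'; apply.
by move=> [df Df]; split=> [x /OO'/df //|v]; apply/IH/Df.
Qed.

Lemma differentiable_near0 f x :
  (\forall y \near x, f y = 0) -> differentiable f x.
Proof.
move=> f0; pose z : {linear 'rV[R]_n -> R} := \0.
have zc : continuous (z : 'rV[R]_n -> R) := @cst_continuous _ _ (0 : R).
have E : f \o shift x = cst (f x) + (z : 'rV[R]_n -> R) +o_ 0 id.
  apply/eqaddoP => e e0; have fx := nbhs_singleton f0.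
  move: f0; rewrite (near_shift 0) subr0 => f0; near=> y.
  rewrite !fctE fx addr0 subr0 (near f0 y)// normr0.
  by rewrite mulr_ge0// ltW.
by apply/diff_locallyP; rewrite (diff_unique zc E).
Unshelve. all: by end_near. Qed.

Lemma differentiable_near f g x :
  (\forall y \near x, f y = g y) -> differentiable f x -> differentiable g x.
Proof.
move=> fg df; rewrite -[g](subrK f); apply: differentiableD => //.
apply: differentiable_near0; near=> y.
by rewrite !fctE (near fg y) ?subrr.
Unshelve. all: by end_near. Qed.

Lemma Ck_ext k O f g : open O -> (forall x, O x -> f x = g x) ->
  Ck k O f -> Ck k O g.
Proof.
move=> oO.
have nearO h h' x : O x -> (forall x, O x -> h x = h' x) ->
    \forall y \near x, h y = h' y :> R.
  move=> Ox hh'; near=> y; apply: hh'; near: y.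
  exact: (open_nbhs_nbhs (conj oO Ox)).
elim: k f g => [|k IH] f g fg /=.
  move=> cf x Ox; rewrite /prop_for /continuous_at -fg//.
  move=> P /(cf x Ox); rewrite !nbhs_simpl /=.
  by apply: filterS2 (nearO _ _ _ Ox fg) => y /= fgy; rewrite /preimage/= fgy.
move=> [df Df]; split=> [x Ox|v].
  exact: (differentiable_near (nearO _ _ _ Ox fg) (df _ Ox)).
by apply: IH (Df v) => x Ox; exact: (near_eq_derive _ (nearO _ _ _ Ox fg)).
Unshelve. all: by end_near. Qed.

Lemma Ck_lin k O c f g : open O -> Ck k O f -> Ck k O g ->
  Ck k O (fun x => c * f x + g x).
Proof.
move=> oO; elim: k f g => [|k IH] f g /=.
  by move=> cf cg x Ox; 
  apply: cvgD (cg x Ox); apply: cvgMl_tmp; exact: cf.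
move=> [df Df] [dg Dg]; have dcf x : O x -> differentiable (c *: f) x.
  by move=> Ox; apply: differentiableZ; exact: df.
split=> [x Ox|v]; first exact: (differentiableD (dcf x Ox) (dg x Ox)).
apply: (Ck_ext oO) (IH _ _ (Df v) (Dg v)) => x Ox.
rewrite [RHS](deriveD (f := c *: f) (g := g)); do ?exact/diff_derivable/dcf.
  by rewrite deriveZ//; exact/diff_derivable/df.
exact/diff_derivable/dg.
Qed.

Lemma Ck_mul k O f g : open O -> Csmooth O f -> Csmooth O g ->
  Ck k O (fun x => f x * g x).
Proof.
move=> oO; elim: k f g => [|k IH] f g sf sg /=.
  by have /= cf := sf 0%N; have /= cg := sg 0%N => x Ox; exact: cvgM (cf x Ox) (cg x Ox).
have [df _] := sf 1%N; have [dg _] := sg 1.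
split=> [x Ox|v]; first exact: (differentiableM (df x Ox) (dg x Ox)).
have Dsf : Csmooth O ('D_v f) by move=> j; have [_] := sf j.+1; apply.
have Dsg : Csmooth O ('D_v g) by move=> j; have [_] := sg j.+1; apply.
apply: (Ck_ext oO) (Ck_lin 1 oO (IH _ _ sf Dsg) (IH _ _ sg Dsf)) => x Ox.
rewrite mul1r [RHS](deriveM (f := f) (g := g))//; do ?exact/diff_derivable/df.
exact/diff_derivable/dg.
Qed.

End euclidean_smoothness.

Record chart (R : realType) (n : nat) (M : topologicalType) := Chart {
  cdom : set M;
  cimg : set 'rV[R]_n;
  cmap : M -> 'rV[R]_n;
  cinv : 'rV[R]_n -> M;
  cdom_open : open cdom;
  cimg_open : open cimg;
  cmap_img : forall p, cdom p -> cimg (cmap p);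
  cinv_dom : forall x, cimg x -> cdom (cinv x);
  cmapK : forall p, cdom p -> cinv (cmap p) = p;
  cinvK : forall x, cimg x -> cmap (cinv x) = x;
  cmap_cont : forall p, cdom p -> {for p, continuous cmap};
  cinv_cont : forall x, cimg x -> {for x, continuous cinv}
}.

Record manifold (R : realType) (n : nat) := Manifold {
  mcarrier :> topologicalType;
  m_hausdorff : hausdorff_space mcarrier;
  m_second_countable : @second_countable mcarrier;
  atlas : set (chart R n mcarrier);
  atlas_cover : forall p : mcarrier, exists2 c, atlas c & cdom c p;
  atlas_compat : forall c c', atlas c -> atlas c' -> forall j : 'I_n,
    Csmooth (cimg c `&` cinv c @^-1` cdom c')
            (fun x => cmap c' (cinv c x) 0 j)
}.

Section calculus.
Context {R : realType} {n : nat} {M : manifold R n}.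

(* Functions, vector fields and forms on an open subset U are represented by
   total objects on M that vanish outside U. *)
Definition res {V : nmodType} (U : set M) (f : M -> V) : M -> V :=
  patch (fun=> 0) U f.

Definition smooth_on (U : set M) (f : M -> R) : Prop :=
  forall c, atlas c -> Csmooth (cimg c `&` cinv c @^-1` U) (f \o cinv c).

Definition smooth_at (p : M) (f : M -> R) : Prop :=
  exists U, [/\ open U, U p & smooth_on U f].

Definition is_fun (U : set M) (f : M -> R) : Prop :=
  smooth_on U f /\ (forall p, ~ U p -> f p = 0).

(* A germ at p is represented by any function that is smooth near p; a
   functional on germs is extended by 0 to the functions not smooth near p. *)
Definition functional := (M -> R) -> R^o.

(* v is in T_p M: a derivation at p of the germs of smooth functions. *)
Record tangent (p : M) (v : functional) : Prop := Tangent {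
  tg_out : forall f, ~ smooth_at p f -> v f = 0;
  tg_local : forall f g, smooth_at p f -> smooth_at p g ->
    (\forall q \near p, f q = g q) -> v f = v g;
  tg_lin : forall c f g, smooth_at p f -> smooth_at p g ->
    v (fun q => c * f q + g q) = c * v f + v g;
  tg_leibniz : forall f g, smooth_at p f -> smooth_at p g ->
    v (fun q => f q * g q) = v f * g p + f p * v g
}.

(* A smooth section X of TM over U; X p f is X_p applied to the germ of f. *)
Record is_vfield (U : set M) (X : M -> functional) : Prop := IsVfield {
  vf_tangent : forall p, U p -> tangent p (X p);
  vf_out : forall p, ~ U p -> X p = 0;
  vf_smooth : forall (V : set M) (f : M -> R), open V -> V `<=` U ->
    smooth_on V f -> smooth_on V (fun p => X p f)
}.

(* A smooth section a of T^*M over U; a p v is the value of the covector a_p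
   on v in T_p M, and is 0 when v is not a tangent vector at p. *)
Record is_form (U : set M) (a : M -> functional -> R^o) : Prop := IsForm {
  fm_tangent : forall p v, ~ tangent p v -> a p v = 0;
  fm_lin : forall p c v w, U p -> tangent p v -> tangent p w ->
    a p (c *: v + w) = c * a p v + a p w;
  fm_out : forall p, ~ U p -> a p = 0;
  fm_smooth : forall (V : set M) (X : M -> functional), open V -> V `<=` U ->
    is_vfield V X -> smooth_on V (fun p => a p (X p))
}.

Definition vact (X : M -> functional) (f : M -> R) : M -> R^o :=
  fun p => X p f.

Definition vbracket (X Y : M -> functional) : M -> functional :=
  fun p f => if `[< smooth_at p f >]
             then X p (vact Y f) - Y p (vact X f) else 0.

Definition dform (f : M -> R) : M -> functional -> R^o :=
  fun p v => if `[< tangent p v >] then v f else 0.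

(* A vector field on a neighbourhood of p with value v at p. *)
Definition extension (p : M) (v : functional) : M -> functional :=
  xget 0 [set Y | (exists V, [/\ open V, V p & is_vfield V Y]) /\ Y p = v].

(* (L_X a)(Y) = X (a(Y)) - a([X, Y]); the right-hand side is tensorial in Y, so
   that its value at p only depends on v = Y_p and not on the extension Y. *)
Definition lie (X : M -> functional) (a : M -> functional -> R^o) :
    M -> functional -> R^o :=
  fun p v => if `[< tangent p v >]
             then let Y := extension p v in
                  X p (fun q => a q (Y q)) - a p (vbracket X Y p) else 0.

(* g^-1 dg on the tangent vector v at p, for a complex-valued g. *)
Definition dlog (g : M -> R[i]) (p : M) (v : functional) : R[i] :=
  (g p)^-1 * (v (fun q => complex.Re (g q)) +i* v (fun q => complex.Im (g q))).

Lemma smooth_on_sub U V f : V `<=` U -> smooth_on U f -> smooth_on V f.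
Proof.
move=> VU sf c ac k; apply: Ck_sub (sf c ac k).
by move=> x [ix Vx]; split=> //; exact: VU.
Qed.

Lemma open_chart (c : chart R n M) U : open U -> open (cimg c `&` cinv c @^-1` U).
Proof.
move=> oU; rewrite openE => x [ix Ux].
apply: (@filterI _ (nbhs x)); first exact: (open_nbhs_nbhs (conj (@cimg_open _ _ _ c) ix)).
exact: (cinv_cont ix) (open_nbhs_nbhs (conj oU Ux)).
Qed.

Lemma smooth_on_lin U c f g : open U -> smooth_on U f -> smooth_on U g ->
  smooth_on U (fun p => c * f p + g p).
Proof.
move=> oU sf sg ch ach k.
exact: (Ck_lin c (@open_chart ch _ oU) (sf ch ach k) (sg ch ach k)).
Qed.

Lemma smooth_on_mul U f g : open U -> smooth_on U f -> smooth_on U g ->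
  smooth_on U (fun p => f p * g p).
Proof.
move=> oU sf sg ch ach k.
exact: (Ck_mul k (@open_chart ch _ oU) (sf ch ach) (sg ch ach)).
Qed.

Lemma smooth_on_cst0 U : open U -> smooth_on U (fun=> 0).
Proof.
move=> oU ch ach k; have oO := @open_chart ch _ oU.
suff : forall O : set 'rV[R]_n, open O -> Ck k O (fun=> 0 : R) by exact.
elim: k => [|k IH] O {}oO; first by move=> x Ox; exact: (@cst_continuous _ _ (0 : R) x).
split=> [x _|v]; first exact: differentiable_cst.
by apply: Ck_ext (IH O oO) => // x _; rewrite derive_cst.
Qed.

Lemma smooth_at2 p f g : smooth_at p f -> smooth_at p g ->
  exists U, [/\ open U, U p, smooth_on U f & smooth_on U g].
Proof.
move=> [U [oU Up sf]] [V [oV Vp sg]]; exists (U `&` V).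
split; [exact: openI|by []|exact: smooth_on_sub sf|exact: smooth_on_sub sg].
Qed.

Lemma smooth_at_lin p c f g : smooth_at p f -> smooth_at p g ->
  smooth_at p (fun q => c * f q + g q).
Proof.
move=> sf sg; have [U [oU Up {}sf {}sg]] := smooth_at2 sf sg.
by exists U; split=> //; exact: smooth_on_lin.
Qed.

Lemma smooth_at_mul p f g : smooth_at p f -> smooth_at p g ->
  smooth_at p (fun q => f q * g q).
Proof.
move=> sf sg; have [U [oU Up {}sf {}sg]] := smooth_at2 sf sg.
by exists U; split=> //; exact: smooth_on_mul.
Qed.

Lemma smooth_at_near p f : smooth_at p f -> \forall q \near p, smooth_at q f.
Proof.
move=> [U [oU Up sf]]; apply: filterS (open_nbhs_nbhs (conj oU Up)) => q Uq.
by exists U.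
Qed.

Lemma smooth_at_vact U X p f : open U -> U p -> is_vfield U X ->
  smooth_at p f -> smooth_at p (vact X f).
Proof.
move=> oU Up vX [V [oV Vp sf]]; exists (U `&` V).
split=> //; first exact: openI.
by apply: (vf_smooth vX); [exact: openI|exact: subIsetl|exact: smooth_on_sub sf].
Qed.

Lemma tangent_lin p c v w : tangent p v -> tangent p w ->
  tangent p (c *: v + w).
Proof.
move=> [ov lv nv bv] [ow lw nw bw].
have E h : (c *: v + w) h = c * v h + w h by [].
split.
- by move=> f nf; rewrite E ov// ow// mulr0 addr0.
- by move=> f g sf sg fg; rewrite !E (lv f g)// (lw f g).
- by move=> d f g sf sg; rewrite !E nv// nw//; ring.
- by move=> f g sf sg; rewrite !E bv// bw//; ring.
Qed.

Lemma tangent0 p : tangent p 0.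
Proof.
have E h : (0 : functional) h = 0 by [].
by split=> // [c f g _ _|f g _ _]; rewrite !E ?mulr0 ?mul0r addr0.
Qed.

Lemma tangent_vbracket U V X Y p : open U -> U p -> open V -> V p ->
  is_vfield U X -> is_vfield V Y -> tangent p (vbracket X Y p).
Proof.
move=> oU Up oV Vp vX vY.
have nU := open_nbhs_nbhs (conj oU Up); have nV := open_nbhs_nbhs (conj oV Vp).
have tX := vf_tangent vX Up; have tY := vf_tangent vY Vp.
have sX f := smooth_at_vact (f := f) oU Up vX.
have sY f := smooth_at_vact (f := f) oV Vp vY.
have E f : smooth_at p f -> vbracket X Y p f = X p (vact Y f) - Y p (vact X f).
  by move=> sf; rewrite /vbracket asboolT.
split.
- by move=> f nf; rewrite /vbracket asboolF.
- move=> f g sf sg fg; rewrite !E//.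
  have near_vact W Z : nbhs p W -> is_vfield W Z ->
      \forall q \near p, vact Z f q = vact Z g q.
    move=> nW vZ; near=> q; apply: (tg_local (p := q)).
    + by apply: (vf_tangent vZ); near: q.
    + by near: q; exact: smooth_at_near.
    + by near: q; exact: smooth_at_near.
    + by near: q; rewrite near_simpl; apply/near_join.
  rewrite (tg_local tX (sY _ sf) (sY _ sg) (near_vact _ _ nV vY)).
  by rewrite (tg_local tY (sX _ sf) (sX _ sg) (near_vact _ _ nU vX)).
- move=> c f g sf sg; rewrite !E//; last exact: smooth_at_lin.
  have near_vact W Z : nbhs p W -> is_vfield W Z -> \forall q \near p,
      vact Z (fun q => c * f q + g q) q = c * vact Z f q + vact Z g q.
    move=> nW vZ; near=> q; apply: (tg_lin (p := q)).
    + by apply: (vf_tangent vZ); near: q.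
    + by near: q; exact: smooth_at_near.
    + by near: q; exact: smooth_at_near.
  rewrite (tg_local tX (sY _ (smooth_at_lin c sf sg))
    (smooth_at_lin c (sY _ sf) (sY _ sg)) (near_vact _ _ nV vY)).
  rewrite (tg_local tY (sX _ (smooth_at_lin c sf sg))
    (smooth_at_lin c (sX _ sf) (sX _ sg)) (near_vact _ _ nU vX)).
  rewrite (tg_lin tX _ (sY _ sf) (sY _ sg)) (tg_lin tY _ (sX _ sf) (sX _ sg)).
  by rewrite mulrBr opprD addrACA.
- move=> f g sf sg; rewrite !E//; last exact: smooth_at_mul.
  have near_vact W Z : nbhs p W -> is_vfield W Z -> \forall q \near p,
      vact Z (fun q => f q * g q) q =
      1 * (vact Z f q * g q) + f q * vact Z g q.
    move=> nW vZ; near=> q; rewrite mul1r; apply: (tg_leibniz (p := q)).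
    + by apply: (vf_tangent vZ); near: q.
    + by near: q; exact: smooth_at_near.
    + by near: q; exact: smooth_at_near.
  have sm Z : (forall f, smooth_at p f -> smooth_at p (vact Z f)) ->
      smooth_at p (fun q => vact Z f q * g q) /\
      smooth_at p (fun q => f q * vact Z g q).
    by move=> sZ; split; apply: smooth_at_mul => //; exact: sZ.
  have [sY1 sY2] := sm _ sY; have [sX1 sX2] := sm _ sX.
  rewrite (tg_local tX (sY _ (smooth_at_mul sf sg))
    (smooth_at_lin 1 sY1 sY2) (near_vact _ _ nV vY)).
  rewrite (tg_local tY (sX _ (smooth_at_mul sf sg))
    (smooth_at_lin 1 sX1 sX2) (near_vact _ _ nU vX)).
  rewrite (tg_lin tX _ sY1 sY2) (tg_lin tY _ sX1 sX2).
  rewrite (tg_leibniz tX (sY _ sf) sg) (tg_leibniz tX sf (sY _ sg)).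
  rewrite (tg_leibniz tY (sX _ sf) sg) (tg_leibniz tY sf (sX _ sg)).
  rewrite /vact; ring.
Unshelve. all: by end_near. Qed.


Lemma is_fun_submod U f g c : open U -> is_fun U f -> is_fun U g ->
  is_fun U (fun p => c * f p + g p).
Proof.
move=> oU [sf f0] [sg g0]; split; first exact: smooth_on_lin.
by move=> p nUp; rewrite f0// g0// mulr0 addr0.
Qed.

Lemma is_fun0 U : open U -> is_fun U (fun=> 0).
Proof. by move=> oU; split=> //; exact: smooth_on_cst0. Qed.

Lemma is_vfield_submod U X Y c : open U -> is_vfield U X -> is_vfield U Y ->
  is_vfield U (c *: X + Y).
Proof.
move=> oU [tX X0 sX] [tY Y0 sY].
have E p : (c *: X + Y) p = c *: X p + Y p by [].
split=> [p Up|p nUp|V f oV VU sf].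
- by rewrite E; apply: tangent_lin; [exact: tX|exact: tY].
- by rewrite E X0// Y0// scaler0 addr0.
- exact: (smooth_on_lin c oV (sX _ _ oV VU sf) (sY _ _ oV VU sf)).
Qed.

Lemma is_vfield0 U : is_vfield U 0.
Proof.
split=> [p _||V f oV _ _] //; first exact: tangent0.
exact: (smooth_on_cst0 oV).
Qed.

Lemma is_form_submod U a b c : open U -> is_form U a -> is_form U b ->
  is_form U (c *: a + b).
Proof.
move=> oU [ta la a0 sa] [tb lb b0 sb].
have E p v : (c *: a + b) p v = c * a p v + b p v by [].
split.
- by move=> p v nt; rewrite E ta// tb// mulr0 addr0.
- by move=> p d v w Up tv tw; rewrite !E la// lb//; ring.
- move=> p nUp; apply/funext => v; rewrite E a0// b0//.
  by rewrite -[LHS]/(c * 0 + 0) mulr0 addr0.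
- move=> V X oV VU vX.
  exact: (smooth_on_lin c oV (sa _ _ oV VU vX) (sb _ _ oV VU vX)).
Qed.

Lemma is_form0 U : is_form U 0.
Proof.
split=> // [p c v w _ _ _|V X oV _ _]; last exact: (smooth_on_cst0 oV).
by rewrite -[LHS]/0 -[0 p v]/0 -[0 p w]/0 mulr0 addr0.
Qed.

Lemma dform_lin c f g p : smooth_at p f -> smooth_at p g ->
  dform (fun q => c * f q + g q) p = c *: dform f p + dform g p.
Proof.
move=> sf sg; apply/funext => v.
rewrite -[RHS]/(c * dform f p v + dform g p v) /dform.
case: asboolP => tv; last by rewrite mulr0 addr0.
exact: (tg_lin tv).
Qed.

Lemma lie_lin U W c X Y a p : open U -> U p -> is_vfield U X ->
  is_vfield U Y -> open W -> W p -> is_form W a ->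
  lie (c *: X + Y) a p = c *: lie X a p + lie Y a p.
Proof.
move=> oU Up vX vY oW Wp fa; apply/funext => v.
rewrite -[RHS]/(c * lie X a p v + lie Y a p v) /lie.
case: asboolP => tv; last by rewrite mulr0 addr0.
have [V [oV Vp vZ]] : exists V, [/\ open V, V p & is_vfield V (extension p v)].
  rewrite /extension; case: xgetP => [Z _ []//|_].
  by exists setT; split; [exact: openT|by []|exact: is_vfield0].
move: (extension p v) vZ => Z vZ /=.
have tZX := tangent_vbracket oU Up oV Vp vX vZ.
have tZY := tangent_vbracket oU Up oV Vp vY vZ.
have -> : vbracket (c *: X + Y) Z p = c *: vbracket X Z p + vbracket Y Z p.
  apply/funext => f.
  rewrite -[RHS]/(c * vbracket X Z p f + vbracket Y Z p f) /vbracket.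
  case: asboolP => sf; last by rewrite mulr0 addr0.
  have -> : vact (c *: X + Y) f = fun q => c * vact X f q + vact Y f q by [].
  rewrite (tg_lin (vf_tangent vZ Vp)); last 2 first.
  - exact: (smooth_at_vact oU Up vX sf).
  - exact: (smooth_at_vact oU Up vY sf).
  rewrite -[(c *: X + Y) p _]/(c * X p (vact Z f) + Y p (vact Z f)); ring.
rewrite (fm_lin fa)//.
rewrite -[(c *: X + Y) p _]/(c * X p _ + Y p _); ring.
Qed.

Lemma dlog_lin g p c v w :
  dlog g p (c *: v + w) = c%:C * dlog g p v + dlog g p w.
Proof.
have E h : (c *: v + w) h = c * v h + w h by [].
rewrite /dlog !E mulrCA -mulrDr; congr (_ * _); apply/eqP.
by rewrite eq_complex /= !mul0r subr0 addr0 !eqxx.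
Qed.

End calculus.

Arguments functional {R n} M.

(* i R is identified with R by t |-> i t (written t*i), so that iR-valued
   functions and forms are represented by real ones; g^-1 dg stays
   complex-valued, and equations with it are stated in R[i]. *)
Section cech.
Context {R : realType} {n : nat} (M : manifold R n) (I : Type).

Record open_cover := OpenCover {
  cov :> I -> set M;
  cov_open : forall i, open (cov i);
  cov_setT : \bigcup_i cov i = setT
}.

Context (U : open_cover).

Record cech2_cocycle := Cech2Cocycle {
  coc :> I -> I -> I -> M -> R[i];
  coc_smooth : forall i j k,
    smooth_on (U i `&` U j `&` U k) (fun p => complex.Re (coc i j k p)) /\
    smooth_on (U i `&` U j `&` U k) (fun p => complex.Im (coc i j k p));
  coc_circle : forall i j k p, U i p -> U j p -> U k p -> `|coc i j k p| = 1;
  coc_cocycle : forall i j k l p, U i p -> U j p -> U k p -> U l p ->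
    coc j k l p * (coc i k l p)^-1 * coc i j l p * (coc i j k p)^-1 = 1
}.

(* The collections of smooth functions u_i : U_i -> i R. *)
Record cochain0 := Cochain0 {
  c0_val :> I -> M -> R^o;
  c0P : forall i, is_fun (U i) (c0_val i)
}.

Lemma c0_eq (u v : cochain0) : c0_val u = c0_val v -> u = v.
Proof.
case: u v => [u uP] [v vP] /= E; subst v.
by congr Cochain0; exact: Prop_irrelevance.
Qed.

Lemma is_c0_lin c (u v : cochain0) i :
  is_fun (U i) ((c *: c0_val u + c0_val v) i).
Proof. exact: (is_fun_submod c (@cov_open U i) (c0P u i) (c0P v i)). Qed.

Lemma is_c00 i : is_fun (U i) ((0 : I -> M -> R^o) i).
Proof. exact: (is_fun0 (@cov_open U i)). Qed.

Definition c00 := Cochain0 is_c00.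

Lemma is_c0D (u v : cochain0) i : is_fun (U i) ((c0_val u + c0_val v) i).
Proof. by have := is_c0_lin 1 u v i; rewrite scale1r. Qed.

Lemma is_c0Z c (u : cochain0) i : is_fun (U i) ((c *: c0_val u) i).
Proof. by have := is_c0_lin c u c00 i; rewrite addr0. Qed.

Lemma is_c0N (u : cochain0) i : is_fun (U i) ((- c0_val u) i).
Proof. by have := is_c0Z (-1) u i; rewrite scaleN1r. Qed.

Definition c0D u v := Cochain0 (is_c0D u v).
Definition c0N u := Cochain0 (is_c0N u).
Definition c0Z c u := Cochain0 (is_c0Z c u).

HB.instance Definition _ := gen_eqMixin cochain0.
HB.instance Definition _ := gen_choiceMixin cochain0.

Fact c0DA : associative c0D.
Proof. by move=> u v w; apply: c0_eq; exact: addrA. Qed.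
Fact c0DC : commutative c0D.
Proof. by move=> u v; apply: c0_eq; exact: addrC. Qed.
Fact c00D : left_id c00 c0D.
Proof. by move=> u; apply: c0_eq; exact: add0r. Qed.
Fact c0ND : left_inverse c00 c0N c0D.
Proof. by move=> u; apply: c0_eq; exact: addNr. Qed.

HB.instance Definition _ := GRing.isZmodule.Build cochain0 c0DA c0DC c00D c0ND.

Fact c0ZA c d u : c0Z c (c0Z d u) = c0Z (c * d) u.
Proof. by apply: c0_eq; exact: scalerA. Qed.
Fact c01Z : left_id 1 c0Z.
Proof. by move=> u; apply: c0_eq; exact: scale1r. Qed.
Fact c0ZDr : right_distributive c0Z +%R.
Proof. by move=> c u v; apply: c0_eq; exact: scalerDr. Qed.
Fact c0ZDl u : {morph c0Z^~ u : c d / c + d}.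
Proof. by move=> c d; apply: c0_eq; exact: scalerDl. Qed.

HB.instance Definition _ :=
  GRing.Zmodule_isLmodule.Build R cochain0 c0ZA c01Z c0ZDr c0ZDl.

Context (g : cech2_cocycle).

Record connection := Connection {
  conn :> I -> I -> M -> functional M -> R^o;
  conn_form : forall i j, is_form (U i `&` U j) (conn i j);
  conn_dlog : forall i j k p v, U i p -> U j p -> U k p -> tangent p v ->
    (conn j k p v - conn i k p v + conn i j p v)*i = dlog (g i j k) p v
}.

Context (A : connection).

Lemma openUU i j : open (U i `&` U j).
Proof. by apply: openI; exact: cov_open. Qed.

(* The objects of L_(g, A): the triples (xi, {f_ij}, {a_i}). *)
Record is_ob (X : M -> functional M) (f : I -> I -> M -> R^o)
    (a : I -> M -> functional M -> R^o) : Prop := IsOb {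
  is_ob_vf : is_vfield setT X;
  is_ob_f : forall i j, is_fun (U i `&` U j) (f i j);
  is_ob_a : forall i, is_form (U i) (a i);
  is_ob_fE : forall i j k p, U i p -> U j p -> U k p ->
    (f j k p - f i k p + f i j p)*i = dlog (g i j k) p (X p);
  is_ob_aE : forall i j p, U i p -> U j p ->
    a j p - a i p = dform (f i j) p - lie X (A i j) p
}.

Record ob := Ob {
  ob_vf : M -> functional M;
  ob_f : I -> I -> M -> R^o;
  ob_a : I -> M -> functional M -> R^o;
  obP : is_ob ob_vf ob_f ob_a
}.

Lemma ob_eq (x y : ob) : ob_vf x = ob_vf y -> ob_f x = ob_f y ->
  ob_a x = ob_a y -> x = y.
Proof.
case: x y => [X f a xP] [Y h b yP] /= EX Ef Ea; subst Y h b.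
by congr Ob; exact: Prop_irrelevance.
Qed.

Lemma is_ob_lin c X f a Y h b : is_ob X f a -> is_ob Y h b ->
  is_ob (c *: X + Y) (c *: f + h) (c *: a + b).
Proof.
move=> [vX sf fa fE aE] [vY sh fb hE bE]; split.
- exact: (is_vfield_submod c openT vX vY).
- by move=> i j; exact: (is_fun_submod c (openUU i j) (sf i j) (sh i j)).
- by move=> i; exact: (is_form_submod c (@cov_open U i) (fa i) (fb i)).
- move=> i j k p Ui Uj Uk.
  have E l m : (c *: f + h) l m p = c * f l m p + h l m p by [].
  have EX : (c *: X + Y) p = c *: X p + Y p by [].
  rewrite EX dlog_lin -fE// -hE// !E; apply/eqP.
  rewrite eq_complex /= mulr0 mul0r subr0 addr0 eqxx mul0r addr0 /=.
  by apply/eqP; ring.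
- move=> i j p Ui Uj; have Uij : (U i `&` U j) p by split.
  rewrite (lie_lin c openT (Logic.I : setT p) vX vY (openUU i j) Uij
    (@conn_form A i j)).
  have sa k : is_fun (U i `&` U j) k -> smooth_at p k.
    by move=> [sk _]; exists (U i `&` U j); split=> //; exact: openUU.
  have -> : (c *: f + h) i j = fun q => c * f i j q + h i j q by [].
  rewrite (dform_lin c (sa _ (sf i j)) (sa _ (sh i j))).
  have E l : (c *: a + b) l p = c *: a l p + b l p by [].
  rewrite !E !opprD addrACA -scalerBr aE// bE//.
  by rewrite scalerBr [RHS]addrACA.
Qed.

Lemma is_ob0 : is_ob 0 0 0.
Proof.
split.
- exact: is_vfield0.
- by move=> i j; exact: (is_fun0 (openUU i j)).
- by move=> i; exact: is_form0.
- move=> i j k p _ _ _; rewrite /dlog -[X in X*i]/(0 - 0 + 0 : R) subrr addr0.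
  by rewrite mulr0.
- move=> i j p Ui Uj; have Uij : (U i `&` U j) p by split.
  have s0 : smooth_at p (fun=> 0).
    by exists setT; split; [exact: openT|by []|exact: smooth_on_cst0 openT].
  have := dform_lin (-1) s0 s0.
  rewrite mulr0 addr0 scaleN1r addNr => ->.
  have := lie_lin (-1) openT (Logic.I : setT p) (is_vfield0 _) (is_vfield0 _)
    (openUU i j) Uij (@conn_form A i j).
  by rewrite scaler0 addr0 scaleN1r addNr => ->; rewrite !subrr.
Qed.

Lemma is_obD x y :
  is_ob (ob_vf x + ob_vf y) (ob_f x + ob_f y) (ob_a x + ob_a y).
Proof.
have := is_ob_lin 1 (obP x) (obP y).
by rewrite !scale1r.
Qed.

Lemma is_obZ c x : is_ob (c *: ob_vf x) (c *: ob_f x) (c *: ob_a x).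
Proof. by have := is_ob_lin c (obP x) is_ob0; rewrite !addr0. Qed.

Lemma is_obN x : is_ob (- ob_vf x) (- ob_f x) (- ob_a x).
Proof. by have := is_obZ (-1) x; rewrite !scaleN1r. Qed.

Definition ob0 := Ob is_ob0.
Definition obD x y := Ob (is_obD x y).
Definition obN x := Ob (is_obN x).
Definition obZ c x := Ob (is_obZ c x).

HB.instance Definition _ := gen_eqMixin ob.
HB.instance Definition _ := gen_choiceMixin ob.

Fact obDA : associative obD.
Proof. by move=> x y z; apply: ob_eq; exact: addrA. Qed.
Fact obDC : commutative obD.
Proof. by move=> x y; apply: ob_eq; exact: addrC. Qed.
Fact ob0D : left_id ob0 obD.
Proof. by move=> x; apply: ob_eq; exact: add0r. Qed.
Fact obND : left_inverse ob0 obN obD.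
Proof. by move=> x; apply: ob_eq; exact: addNr. Qed.

HB.instance Definition _ := GRing.isZmodule.Build ob obDA obDC ob0D obND.

Fact obZA c d x : obZ c (obZ d x) = obZ (c * d) x.
Proof. by apply: ob_eq; exact: scalerA. Qed.
Fact ob1Z : left_id 1 obZ.
Proof. by move=> x; apply: ob_eq; exact: scale1r. Qed.
Fact obZDr : right_distributive obZ +%R.
Proof. by move=> c x y; apply: ob_eq; exact: scalerDr. Qed.
Fact obZDl x : {morph obZ^~ x : c d / c + d}.
Proof. by move=> c d; apply: ob_eq; exact: scalerDl. Qed.

HB.instance Definition _ :=
  GRing.Zmodule_isLmodule.Build R ob obZA ob1Z obZDr obZDl.

End cech.

(* Main.v *)
(* Written out, every axiom of the L_oo-algebra is one of the Cartan identities
   [L_X, L_Y] = L_[X,Y], L_X d = d L_X, the Jacobi identity for vector fields,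
   or the fact that g^-1 dg is closed; hence J = 0 works.

   Since L_X a is defined at a tangent vector v through an arbitrary local
   extension Y of v, these identities need two facts: every v extends, and
   X(a(Y)) - a([X, Y]) only depends on the value of Y at the point.  Both follow
   from the existence of local frames of the tangent bundle, that is, from the
   coordinate formula v f = sum_j v(x_j) d_j f for an abstract derivation v.  It
   rests on Hadamard's lemma f(x) = f(x0) + sum_j (x - x0)_j g_j(x), where g_j
   is the mean of d_j f over the segment from x0 to x; the weighted means
   (m_k f)(x) = int_0^1 t^k f(x0 + t (x - x0)) dt satisfy
   D_v (m_k f) = m_(k+1) (D_v f), which makes g_j = m_0 (d_j f) smooth. *)
Require Import Defs.
From HB Require Import structures.
From mathcomp Require Import all_boot all_order all_algebra.
From mathcomp Require Import all_classical all_reals all_analysis.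
From mathcomp Require Import ring lra.
Import Order.TTheory GRing.Theory Num.Theory.
Import numFieldNormedType.Exports.
Local Open Scope classical_set_scope.
Local Open Scope ring_scope.

Set Implicit Arguments.
Unset Strict Implicit.
Unset Printing Implicit Defensive.

(** * Smooth functions on open subsets of R^n *)

Section euclidean.
Context {R : realType} {n : nat}.
Implicit Types (O : set 'rV[R]_n) (f g : 'rV[R]_n -> R).

Lemma Ck_differentiable k O f x : Ck k.+1 O f -> O x -> differentiable f x.
Proof. by case=> df _; exact: df. Qed.

Lemma CkS k O f : Ck k.+1 O f -> Ck k O f.
Proof.
elim: k f => [|k IH] f [df Df]; last by split=> // v; exact: IH.
by move=> x Ox; exact/differentiable_continuous/df.
Qed.

(** In [Ck] the derivatives are those of the total function, and the set only says at which points
    they are tested. Hence the condition splits over singletons, which makes smoothness a local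
    property. *)
Lemma Ck_pointwise k O f : (forall x, O x -> Ck k [set x] f) -> Ck k O f.
Proof.
elim: k f => [|k IH] f Cf /=; first by move=> x Ox; exact: (Cf x Ox x).
split=> [x Ox|v]; first by have [+ _] := Cf x Ox; exact.
by apply: IH => x Ox; have [_] := Cf x Ox; exact.
Qed.

Lemma Csmooth_derive O f v : Csmooth O f -> Csmooth O ('D_v f).
Proof. by move=> sf k; have [_] := sf k.+1; exact. Qed.

Lemma Csmooth_differentiable O f x : Csmooth O f -> O x -> differentiable f x.
Proof. by move=> sf; exact: (Ck_differentiable (sf 1%N)). Qed.

Lemma Ck_cst k O c : open O -> Ck k O (fun=> c).
Proof.
move=> oO; elim: k c => [|k IH] c /=.
  by move=> x _; exact: cst_continuous.
split=> [x _|v]; first exact: differentiable_cst.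
by apply: Ck_ext (IH 0) => // x _; rewrite derive_cst.
Qed.

(** The finite-order product rule: both factors are only assumed C^k, as the induction in the chain
    rule requires. [CkS] supplies the lower order of the undifferentiated factor. *)
Lemma Ck_mulr k O f g : open O -> Ck k O f -> Ck k O g ->
  Ck k O (fun x => f x * g x).
Proof.
move=> oO; elim: k f g => [|k IH] f g Cf Cg.
  by move=> x Ox; exact: cvgM (Cf x Ox) (Cg x Ox).
have [df Df] := Cf; have [dg Dg] := Cg.
split=> [x Ox|v]; first exact: (differentiableM (df x Ox) (dg x Ox)).
have := Ck_lin 1 oO (IH _ _ (CkS Cf) (Dg v)) (IH _ _ (CkS Cg) (Df v)).
apply: (Ck_ext oO) => x Ox; rewrite mul1r [RHS](deriveM (f := f) (g := g))//.
  exact/diff_derivable/df.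
exact/diff_derivable/dg.
Qed.

Lemma Ck_sum k O m (f : 'I_m -> 'rV[R]_n -> R) : open O ->
  (forall i, Ck k O (f i)) -> Ck k O (fun x => \sum_(i < m) f i x).
Proof.
move=> oO; elim: m f => [|m IH] f Cf.
  by apply: (Ck_ext oO) (Ck_cst k 0 oO) => x _; rewrite big_ord0.
have := Ck_lin 1 oO (Cf ord0) (IH _ (fun i => Cf (lift ord0 i))).
by apply: (Ck_ext oO) => x _; rewrite mul1r big_ord_recl.
Qed.

Lemma derive_coord f x v : differentiable f x ->
  'D_v f x = \sum_(j < n) v 0 j * 'D_(delta_mx 0 j) f x.
Proof.
move=> df; rewrite deriveE// {1}(row_sum_delta v) linear_sum.
by apply: eq_bigr => j _; rewrite linearZ /= deriveE.
Qed.

Lemma differentiable_row m (F : 'rV[R]_n -> 'rV[R]_m) x :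
  (forall j, differentiable (fun y => F y 0 j) x) -> differentiable F x.
Proof.
move=> dF; have -> : F = \sum_(j < m) (fun y => F y 0 j *: delta_mx 0 j).
  by apply/funext => y; rewrite {1}(row_sum_delta (F y)) fct_sumE.
by apply: differentiable_sum => j; exact: differentiableZl.
Qed.

End euclidean.

(** * Composition with smooth maps *)

Section chain_rule.
Context {R : realType} {n : nat} (O O' : set 'rV[R]_n).
Hypotheses (oO : open O).
Variable F : 'rV[R]_n -> 'rV[R]_n.
Hypotheses (sF : forall j, Csmooth O (fun x => F x 0 j)).
Hypothesis (FO : forall x, O x -> O' (F x)).

Let dF x : O x -> differentiable F x.
Proof.
by move=> Ox; apply: differentiable_row => j; exact: Csmooth_differentiable Ox.
Qed.

(** Induction on the order, for all [f] at once, through D_v (f o F) = sum_j D_v F_j * (d_j f o F):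
    the induction hypothesis is applied to the partial derivatives of [f]. *)
Lemma Csmooth_comp f : Csmooth O' f -> Csmooth O (f \o F).
Proof.
move=> + k; elim: k f => [|k IH] f sf.
  move=> x Ox; apply: continuous_comp; first exact/differentiable_continuous/dF.
  exact: (sf 0%N) (FO Ox).
have df x : O x -> differentiable f (F x).
  by move=> Ox; exact: Csmooth_differentiable sf (FO Ox).
split=> [x Ox|v]; first exact: differentiable_comp (dF Ox) (df _ Ox).
apply: (Ck_ext (f := fun x => \sum_(j < n)
    'D_v (fun y => F y 0 j) x * ('D_(delta_mx 0 j) f \o F) x) oO); last first.
  apply: Ck_sum => // j; apply: Ck_mulr => //.
    exact: (Csmooth_derive v (@sF j) k).
  exact/IH/Csmooth_derive.
move=> x Ox; have dFx := dF Ox.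
rewrite (deriveE v (differentiable_comp dFx (df _ Ox))) diff_comp//=;
  last first.
  exact: df.
rewrite -(deriveE v dFx) -(deriveE _ (df _ Ox)).
rewrite derive_coord; last exact: df.
rewrite derive_mx; last exact: diff_derivable.
by apply: eq_bigr => j _; rewrite mxE.
Qed.

End chain_rule.

(** * Hadamard's lemma *)

Section radial_mean.
Context {R : realType} {n : nat} (O : set 'rV[R]_n) (x0 : 'rV[R]_n).
Hypothesis oO : open O.
Notation mu := (@lebesgue_measure R).
Implicit Types (f h : 'rV[R]_n -> R) (x y v w : 'rV[R]_n) (t e : R).

Definition ray x t := x0 + t *: (x - x0).

Hypothesis starO : forall x t, O x -> 0 <= t <= 1 -> O (ray x t).

Definition radial_mean k h x : R :=
  \int[mu]_(t in `[0, 1]) (t ^+ k * h (ray x t)).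

(** The difference quotients on both sides coincide term by term, so existence and value of the
    limit transfer together. *)
Lemma is_derive_line h a w t : differentiable h (a + t *: w) ->
  is_derive t 1 (fun s => h (a + s *: w)) ('D_w h (a + t *: w)).
Proof.
move=> /diff_derivable-/(_ w); have E : (fun r => r^-1 *:
    (h (r *: w + (a + t *: w)) - h (a + t *: w))) =
    (fun r => r^-1 *: (h (a + (r *: 1 + t) *: w) - h (a + t *: w))).
  apply/funext => r; congr (_ *: (h _ - _)).
  by rewrite [r *: 1]mulr1 scalerDl addrCA.
by rewrite /derivable E => dh; apply: DeriveDef => //; rewrite /derive E.
Qed.

Lemma continuous_linear_rV (L : {linear 'rV[R]_n -> R}) : continuous L.
Proof.
move=> x; apply: differentiable_continuous.
have -> : (L : 'rV[R]_n -> R) =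
    \sum_(j < n) (fun v => v 0 j *: L (delta_mx 0 j)).
  apply/funext => v; rewrite {1}(row_sum_delta v) linear_sum fct_sumE.
  by apply: eq_bigr => j _; rewrite linearZ.
apply: differentiable_sum => j; apply: differentiableZl.
exact: differentiable_coord.
Qed.

(** Linear maps on R^n are continuous, so a first-order approximation by [L] forces [L] to be the
    differential, by uniqueness. *)
Lemma differentiable_approx f (x : 'rV[R]_n : normedModType R)
    (L : {linear 'rV[R]_n -> R}) :
  (forall e, 0 < e ->
     \forall y \near (0 : 'rV[R]_n), `|f (y + x) - f x - L y| <= e * `|y|) ->
  differentiable f x /\ forall v, 'D_v f x = L v.
Proof.
move=> H; have cL := @continuous_linear_rV L.
have E : f \o shift x = cst (f x) + (L : 'rV[R]_n -> R) +o_ 0 id.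
  apply/eqaddoP => e e0; near=> y.
  rewrite !fctE opprD addrA.
  by near: y; exact: H.
have dE := diff_unique cL E.
have df : differentiable f x by apply/diff_locallyP; rewrite dE.
by split=> // v; rewrite deriveE// dE.
Unshelve. all: by end_near.
Qed.

Lemma continuous01_integrable (phi : R -> R) :
  (forall t, 0 <= t <= 1 -> {for t, continuous phi}) ->
  mu.-integrable `[0, 1] (EFin \o phi).
Proof.
move=> cphi; apply: continuous_compact_integrable; first exact: segment_compact.
apply: continuous_in_subspaceT => t; rewrite inE /= in_itv /=.
exact: cphi.
Qed.

Lemma ray_continuous x : continuous (ray x).
Proof.
move=> t; apply: cvgD; first exact: cvg_cst.
by apply: cvgZr_tmp; exact: cvg_id.
Qed.

Lemma radial_integrand_continuous k h x :
  (forall y, O y -> {for y, continuous h}) -> O x ->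
  forall t, 0 <= t <= 1 -> {for t, continuous (fun t => t ^+ k * h (ray x t))}.
Proof.
move=> ch Ox t t01; apply: cvgM; first exact: exprn_continuous.
by apply: continuous_comp; [exact: ray_continuous|exact/ch/starO].
Qed.

Lemma radial_integrable k h x :
  (forall y, O y -> {for y, continuous h}) -> O x ->
  mu.-integrable `[0, 1] (EFin \o (fun t => t ^+ k * h (ray x t))).
Proof.
by move=> ch Ox; apply: continuous01_integrable;
  exact: radial_integrand_continuous.
Qed.

(** Provides the candidate differential of a radial mean, and the linear form that Hadamard's
    formula expands in the standard basis. *)
Lemma radial_mean_lin k h x : Csmooth O h -> O x ->
  linear (fun v => radial_mean k ('D_v h) x : R^o).
Proof.
move=> sh Ox c v w.
have ch u := radial_integrable k (Csmooth_derive u sh 0%N) Ox.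
rewrite /radial_mean -[X in _ = X + _]/(c * _) -RintegralZl// -RintegralD//;
  last first.
  apply: continuous01_integrable => t t01; apply: cvgMl_tmp.
  exact: (radial_integrand_continuous (Csmooth_derive v sh 0%N) Ox t01).
apply: eq_Rintegral => t; rewrite inE /= in_itv /= => t01.
have dh := Csmooth_differentiable sh (starO Ox t01).
by rewrite !deriveE// linearP mulrDr mulrCA.
Qed.

(** Continuity of [h] gives, for each t, a neighbourhood of 0 that also serves nearby parameters;
    compactness of [0, 1] makes one neighbourhood serve all of them. *)
Lemma ray_uniform_near h x e :
  (forall y, O y -> {for y, continuous h}) -> O x -> 0 < e ->
  \forall y \near (0 : 'rV[R]_n),
    forall t, 0 <= t <= 1 -> `|h (y + ray x t) - h (ray x t)| <= e.
Proof.
move=> ch Ox e0.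
have /compact_near_coveringP cov01 := @segment_compact R 0 1.
suff near01 : forall t, `[0, 1]%classic t -> \forall t' \near t &
    y \near (0 : 'rV[R]_n), `|h (y + ray x t') - h (ray x t')| <= e.
  have nearK := cov01 _ (nbhs (0 : 'rV[R]_n))
    (fun y t => `|h (y + ray x t) - h (ray x t)| <= e)
    (nbhs_filter (0 : 'rV[R]_n)) near01.
  apply: filterS nearK => y H t t01.
  by apply: H; rewrite /= in_itv.
move=> t; rewrite /= in_itv/= => t01.
(* The parameter moves as well, so both values are compared with the fixed value at [ray x t], each
   within half of [e]. *)
have /cvgrPdist_lt/(_ (e / 2)) := ch _ (starO Ox t01).
rewrite divr_gt0// => /(_ isT) hW.
have c1 : (fun p : R * 'rV[R]_n => ray x p.1)
      @ filter_prod (nbhs t) (nbhs (0 : 'rV[R]_n)) --> ray x t.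
  by apply: (cvg_comp _ _ cvg_fst); exact: ray_continuous.
have c2 : (fun p : R * 'rV[R]_n => p.2 + ray x p.1)
      @ filter_prod (nbhs t) (nbhs (0 : 'rV[R]_n)) --> ray x t.
  by rewrite -[X in _ --> X]add0r; apply: cvgD => //; exact: cvg_snd.
have w1 := c1 _ hW; have w2 := c2 _ hW.
have FF := filter_prod_filter (nbhs_filter t) (nbhs_filter (0 : 'rV[R]_n)).
apply: (@filterS2 _ _ FF _ _ _ _ w1 w2) => p /= pw1 pw2.
rewrite (le_trans (ler_distD (h (ray x t)) _ _))// (splitr e).
by rewrite lerD//; [rewrite distrC|]; exact: ltW.
Qed.


Lemma coord_le_norm y i : `|y 0 i| <= `|y|.
Proof. by rewrite [leRHS]mx_normrE; exact: (le_bigmax _ _ (0, i)). Qed.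

(** The mean value theorem on the segment from [ray x t] to [ray (y + x) t] turns the error into a
    difference of derivatives in the direction t y. Each of the n partial derivatives varies by at
    most [e], whence the factor n. *)
Lemma radial_increment h x y e t : Csmooth O h -> O x -> 0 <= t <= 1 ->
  (forall s : R, 0 <= s <= 1 -> O (s *: y + x)) ->
  (forall (s : R) i, 0 <= s <= 1 ->
    `|'D_(delta_mx 0 i) h (s *: y + ray x t) -
      'D_(delta_mx 0 i) h (ray x t)| <= e) ->
  `|h (ray (y + x) t) - h (ray x t) - t * 'D_y h (ray x t)| <= n%:R * e * `|y|.
Proof.
move=> sh Ox t01 Oy he; have /andP[t0 t1] := t01.
have E (s : R) : ray (s *: y + x) t = ray x t + s *: (t *: y).
  by rewrite /ray -addrA scalerDr addrCA addrC scalerA mulrC -scalerA.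
have dh (s : R) : 0 <= s <= 1 -> differentiable h (ray x t + s *: (t *: y)).
  move=> s01; rewrite -E.
  exact: Csmooth_differentiable sh (starO (Oy _ s01) t01).
have dl (s : R) : s \in `]0, 1[%R ->
    is_derive s 1 (fun s => h (ray x t + s *: (t *: y)))
                  ('D_(t *: y) h (ray x t + s *: (t *: y))).
  by rewrite in_itv /= => /andP[s0 s1]; apply/is_derive_line/dh; rewrite !ltW.
have cl : {within `[0, 1], continuous (fun s => h (ray x t + s *: (t *: y)))}.
  apply: continuous_in_subspaceT => s; rewrite inE /= in_itv /= => /dh.
  by move=> /is_derive_line[/derivable1_diffP/differentiable_continuous].
have [s] := MVT_segment ler01 dl cl.
rewrite in_itv /= => s01; rewrite subr0 mulr1 scale0r addr0 -E scale1r => ->.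
have dx : differentiable h (ray x t).
  by have := dh 0; rewrite scale0r addr0; apply; rewrite lexx ler01.
have -> : t * 'D_y h (ray x t) = 'D_(t *: y) h (ray x t).
  by rewrite !deriveE// linearZ.
rewrite (derive_coord _ (dh _ s01)) (derive_coord _ dx) -sumrB.
apply: le_trans (ler_norm_sum _ _ _) _.
(* Reading n as the number of indices turns the bound into a constant sum, to be compared
   termwise. *)
rewrite -[X in X%:R]card_ord -mulrA mulr_natl -sumr_const.
apply: ler_sum => i _.
rewrite -mulrBr normrM mulrC ler_pM//.
  rewrite [ray x t + _]addrC scalerA; apply: he.
  rewrite mulr_ge0//= ?mulr_ile1//.
  - by case/andP: s01.
  - by case/andP: s01.
  - by case/andP: s01.
rewrite mxE normrM ger0_norm// (le_trans _ (coord_le_norm y i))//.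
by rewrite ler_piMl.
Qed.

Lemma Rintegral01_cst (c : R) : \int[mu]_(t in `[0, 1]) c = c.
Proof.
rewrite Rintegral_cst//= lebesgue_measure_itv /= lte_fin ltr01 oppr0 adde0 /=.
by rewrite mulr1.
Qed.

Lemma Rintegral01_le (phi : R -> R) (c : R) :
  (forall t, 0 <= t <= 1 -> {for t, continuous phi}) ->
  (forall t, 0 <= t <= 1 -> `|phi t| <= c) ->
  `|\int[mu]_(t in `[0, 1]) phi t| <= c.
Proof.
move=> cphi phic; have iphi := continuous01_integrable cphi.
rewrite (le_trans (le_normr_Rintegral _ iphi))// -[leRHS]Rintegral01_cst.
apply: le_Rintegral => //.
- by apply: continuous01_integrable => t t01; apply: cvg_norm; exact: cphi.
- by apply: continuous01_integrable => t t01; exact: cst_continuous.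
Qed.

(** Differentiation under the integral: the first-order error of the integrand is small uniformly in
    t, hence so is its integral. The chain rule contributes a factor t, which raises the weight from
    k to k + 1. *)
Lemma radial_mean_diff k h x : Csmooth O h -> O x ->
  differentiable (radial_mean k h) x /\
  forall v, 'D_v (radial_mean k h) x = radial_mean k.+1 ('D_v h) x.
Proof.
move=> sh Ox; have Llin := radial_mean_lin k.+1 sh Ox.
pose LM := GRing.isLinear.Build _ _ _ _ _ Llin.
pose L : {linear 'rV[R]_n -> R} :=
  HB.pack (fun v => radial_mean k.+1 ('D_v h) x : R) LM.
apply: (differentiable_approx (L := L)) => e e0.
(* [radial_increment] costs a factor n; dividing by n + 1 absorbs it and stays meaningful for n =
   0. *)
pose e' := e / n.+1%:R; have e'0 : 0 < e' by rewrite divr_gt0.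
have nearD : \forall y \near (0 : 'rV[R]_n), forall (t : R) i, 0 <= t <= 1 ->
    `|'D_(delta_mx 0 i) h (y + ray x t) - 'D_(delta_mx 0 i) h (ray x t)| <= e'.
  near=> y => t i; move: i t; near: y; apply: filter_forall => i.
  exact: (ray_uniform_near (Csmooth_derive _ sh 0%N) Ox e'0).
have /nbhs_ballP[d d0 dD] := nearD.
have /nbhs_ballP[r r0 rO] : nbhs x O by exact: open_nbhs_nbhs.
(* The radius [d] controls the partial derivatives, and [r] keeps the segment from x to y + x inside
   [O]. *)
apply/nbhs_ballP; exists (Num.min d r); first by rewrite /= lt_min d0.
move=> y; rewrite -ball_normE /= sub0r normrN lt_min => /andP[yd yr].
have sy s : 0 <= s <= 1 -> `|s *: y| <= `|y|.
  by move=> /andP[s0 s1]; rewrite normrZ ger0_norm// ler_piMl.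
have Oy s : 0 <= s <= 1 -> O (s *: y + x).
  move=> s01; apply: rO; rewrite -ball_normE /= opprD addrCA subrr addr0 normrN.
  exact: le_lt_trans (sy _ s01) yr.
have Oyx : O (y + x).
  by have := Oy 1; rewrite scale1r; apply; rewrite ler01 lexx.
have ch := sh 0%N; have cDh := Csmooth_derive y sh 0%N.
have c1 := radial_integrand_continuous (k := k) ch Ox.
have c2 := radial_integrand_continuous (k := k) ch Oyx.
have c3 := radial_integrand_continuous (k := k.+1) cDh Ox.
have c21 (t : R) : 0 <= t <= 1 -> {for t, continuous (fun t =>
    t ^+ k * h (ray (y + x) t) - t ^+ k * h (ray x t))}.
  by move=> t01; apply: cvgB; [exact: c2|exact: c1].
rewrite /= /radial_mean -RintegralB//; do ?exact: continuous01_integrable.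
rewrite -RintegralB//; do ?exact: continuous01_integrable.
apply: Rintegral01_le => t t01.
  by apply: cvgB; [exact: c21|exact: c3].
rewrite exprSr -mulrA -!mulrBr normrM.
have /andP[t0 t1] := t01.
rewrite -[leRHS]mul1r ler_pM//.
  by rewrite normrX ger0_norm// exprn_ile1.
have De (s : R) i : 0 <= s <= 1 ->
    `|'D_(delta_mx 0 i) h (s *: y + ray x t) -
      'D_(delta_mx 0 i) h (ray x t)| <= e'.
  move=> s01; apply: dD => //; rewrite -ball_normE /= sub0r normrN.
  exact: le_lt_trans (sy _ s01) yd.
apply: (le_trans (radial_increment sh Ox t01 Oy De)).
rewrite ler_wpM2r// /e' mulrCA ler_piMr ?ltW//.
by rewrite ltr_pdivrMr// mul1r ltr_nat.
Unshelve. all: by end_near. Qed.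

(** The weight and the function must vary in the induction on the order, since differentiating
    changes both. *)
Lemma Csmooth_radial_mean k h : Csmooth O h -> Csmooth O (radial_mean k h).
Proof.
move=> + m; elim: m k h => [|m IH] k h sh.
  move=> x Ox; apply: differentiable_continuous.
  by have [] := radial_mean_diff k sh Ox.
split=> [x Ox|v]; first by have [] := radial_mean_diff k sh Ox.
apply: (Ck_ext oO) (IH k.+1 _ (Csmooth_derive v sh)) => x Ox.
by have [_ ->] := radial_mean_diff k sh Ox.
Qed.

Lemma radial_mean_center h : radial_mean 0 h x0 = h x0.
Proof.
rewrite -[RHS]Rintegral01_cst; apply: eq_Rintegral => t _.
by rewrite expr0 mul1r /ray subrr scaler0 addr0.
Qed.

Lemma hadamard h x : Csmooth O h -> O x ->
  h x = h x0 +
    \sum_(j < n) (x - x0) 0 j * radial_mean 0 ('D_(delta_mx 0 j) h) x.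
Proof.
move=> sh Ox; apply/eqP; rewrite addrC -subr_eq; apply/eqP.
have cD v := radial_integrand_continuous (k := 0) (Csmooth_derive v sh 0%N) Ox.
have dh (t : R) : 0 <= t <= 1 -> differentiable h (x0 + t *: (x - x0)).
  by move=> t01; apply: Csmooth_differentiable sh (starO Ox t01).
have cF (t : R) : 0 <= t <= 1 -> {for t, continuous (fun t => h (ray x t))}.
  move=> t01; have := sh 0%N _ (starO Ox t01).
  by apply: continuous_comp; exact: ray_continuous.
(* The fundamental theorem of calculus along the ray; linearity in the direction x - x0 then gives
   the sum over coordinates. *)
have -> : h x - h x0 = radial_mean 0 ('D_(x - x0) h) x.
  rewrite /radial_mean /Rintegral.
  rewrite (@continuous_FTC2 _ _ (fun t => h (ray x t)) 0 1)//=.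
  - by rewrite {2}/ray scale0r addr0 /ray scale1r [x0 + _]addrC subrK.
  - by apply: continuous_in_subspaceT => t; rewrite inE /= in_itv /=; exact: cD.
  - split=> [t||].
    + rewrite in_itv /= => /andP[t0 t1].
      have t01 : 0 <= t <= 1 by rewrite !ltW.
      by have [] := is_derive_line (dh t t01).
    + by apply: cvg_at_right_filter; apply: cF; rewrite lexx ler01.
    + by apply: cvg_at_left_filter; apply: cF; rewrite lexx ler01.
  - move=> t; rewrite in_itv /= expr0 mul1r derive1E => /andP[t0 t1].
    have t01 : 0 <= t <= 1 by rewrite !ltW.
    by have [_ ->] := is_derive_line (dh t t01).
have Dlin := radial_mean_lin 0 sh Ox.
pose DM := GRing.isLinear.Build _ _ _ _ _ Dlin.
pose D : {linear 'rV[R]_n -> R^o} :=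
  HB.pack (fun v => radial_mean 0 ('D_v h) x : R^o) DM.
rewrite -[LHS]/(D (x - x0)) {1}(row_sum_delta (x - x0)) linear_sum.
by apply: eq_bigr => j _; rewrite linearZ.
Qed.

End radial_mean.

(** * Germs of smooth functions *)

Section germs.
Context {R : realType} {n : nat} {M : manifold R n}.
Implicit Types (p q : M) (f g : M -> R) (U V : set M) (X Y : M -> functional M).

Lemma smooth_on_ext U f g : open U -> (forall p, U p -> f p = g p) ->
  smooth_on U f -> smooth_on U g.
Proof.
move=> oU fg sf c ac k; apply: Ck_ext (sf c ac k); first exact: open_chart.
by move=> x [_]; exact: fg.
Qed.

Lemma smooth_at_ext p f g : (\forall q \near p, f q = g q) ->
  smooth_at p f -> smooth_at p g.
Proof.
rewrite /prop_near1 nbhsE => -[V [oV Vp] fg] [U [oU Up sf]]; exists (U `&` V).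
split=> //; first exact: openI.
apply: (smooth_on_ext (f := f)); first exact: openI.
  by move=> q [_ Vq]; exact: fg.
by apply: smooth_on_sub sf; exact: subIsetl.
Qed.

Lemma smooth_on_local U f : (forall p, U p -> smooth_at p f) -> smooth_on U f.
Proof.
move=> sf c ac k; apply: Ck_pointwise => x [cx Ux].
have [V [oV Vx sV]] := sf _ Ux.
by apply: Ck_sub (sV c ac k) => _ ->.
Qed.

Lemma smooth_on_at U f p : open U -> U p -> smooth_on U f -> smooth_at p f.
Proof. by move=> oU Up sf; exists U. Qed.

Lemma smooth_at_cst p (c : R) : smooth_at p (fun=> c).
Proof.
exists setT; split=> //; first exact: openT.
by move=> ch ac k; apply: Ck_cst; apply: open_chart openT.
Qed.

Lemma smooth_atB p f g : smooth_at p f -> smooth_at p g ->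
  smooth_at p (fun q => f q - g q).
Proof.
move=> sf sg; apply: smooth_at_ext (smooth_at_lin (-1) sg sf).
by near=> q; rewrite mulN1r addrC.
Unshelve. all: by end_near. Qed.

Lemma smooth_at_sum m p (f : 'I_m -> M -> R) : (forall i, smooth_at p (f i)) ->
  smooth_at p (fun q => \sum_(i < m) f i q).
Proof.
move=> sf; elim: m f sf => [|m IH] f sf.
  by apply: smooth_at_ext (smooth_at_cst p 0); near=> q; rewrite big_ord0.
have := smooth_at_lin 1 (sf ord0) (IH _ (fun i => sf (lift ord0 i))).
by apply: smooth_at_ext; near=> q; rewrite mul1r big_ord_recl.
Unshelve. all: by end_near. Qed.

Lemma tangentB p v f g : tangent p v -> smooth_at p f -> smooth_at p g ->
  v (fun q => f q - g q) = v f - v g.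
Proof.
move=> tv sf sg; have := tg_lin tv (-1) sg sf.
have -> : (fun q => -1 * g q + f q) = (fun q => f q - g q).
  by apply/funext => q; rewrite mulN1r addrC.
by move=> ->; rewrite mulN1r addrC.
Qed.

(** Leibniz applied to 1 * 1 gives v(1) = v(1) + v(1); linearity does the rest. *)
Lemma tangent_cst p v (c : R) : tangent p v -> v (fun=> c) = 0.
Proof.
move=> tv; have s := smooth_at_cst p.
have v0 : v (fun=> 0) = 0.
  have := tg_lin tv (-1) (s 0) (s 0).
  by rewrite mulr0 addr0 mulN1r addNr.
have v1 : v (fun=> 1) = 0.
  apply: (@addrI _ (v (fun=> 1))); rewrite addr0.
  by have := tg_leibniz tv (s 1) (s 1); rewrite !mulr1 mul1r.
have := tg_lin tv c (s 1) (s 0).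
by rewrite mulr1 addr0 v1 v0 mulr0 addr0.
Qed.

Lemma tangent_sum m p v (f : 'I_m -> M -> R) : tangent p v ->
  (forall i, smooth_at p (f i)) ->
  v (fun q => \sum_(i < m) f i q) = \sum_(i < m) v (f i).
Proof.
move=> tv; elim: m f => [|m IH] f sf.
  rewrite big_ord0 -[RHS](tangent_cst 0 tv); congr v.
  by apply/funext => q; rewrite big_ord0.
rewrite big_ord_recl -IH; last by move=> i; exact: sf.
rewrite -[X in _ = X + _]mul1r -(tg_lin tv)//; last first.
  apply: smooth_at_sum => i. exact: sf.
by congr v; apply/funext => q; rewrite mul1r big_ord_recl.
Qed.

(** The default value imposed by [tg_out] leaves no freedom outside the smooth germs, so tangent
    vectors can be equated as functions. *)
Lemma tangent_eq p v w : tangent p v -> tangent p w ->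
  (forall f, smooth_at p f -> v f = w f) -> v = w.
Proof.
move=> tv tw vw; apply/funext => f; have [sf|nsf] := pselect (smooth_at p f).
  exact: vw.
by rewrite (tg_out tv)// (tg_out tw).
Qed.

End germs.

(** * Local frames *)

Section frame.
Context {R : realType} {n : nat} {M : manifold R n}.
Implicit Types (p q : M) (f g : M -> R) (X Y : M -> functional M).

(* The germ of X at p is one of a smooth vector field; unlike is_vfield, this
   asks nothing of X away from p. *)
Definition vf_at p X : Prop := \forall q \near p, tangent q (X q) /\
  forall f, smooth_at q f -> smooth_at q (vact X f).

Section coordinates.
Variable c : chart R n M.
Hypothesis ac : atlas c.

Lemma open_cmap_preimage (O : set 'rV[R]_n) : open O ->
  open (cdom c `&` cmap c @^-1` O).
Proof.
move=> oO; rewrite openE => p [cp Op].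
apply: (@filterI _ (nbhs p)).
  exact: (open_nbhs_nbhs (conj (@cdom_open _ _ _ c) cp)).
exact: (cmap_cont cp) (open_nbhs_nbhs (conj oO Op)).
Qed.

(** Read in another chart, the pulled-back function is [G] composed with a transition map, which is
    smooth by compatibility of the atlas. *)
Lemma smooth_on_chart (O : set 'rV[R]_n) G : open O -> Csmooth O G ->
  smooth_on (cdom c `&` cmap c @^-1` O) (G \o cmap c).
Proof.
move=> oO sG c' ac'.
apply: (@Csmooth_comp _ _ _ O _ (cmap c \o cinv c')) sG.
- exact/open_chart/open_cmap_preimage.
- move=> j k; apply: Ck_sub (atlas_compat ac' ac j k).
  by move=> x [c'x [cx _]].
- by move=> x [_ []].
Qed.

Lemma smooth_at_chart f q : smooth_at q f -> cdom c q ->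
  exists O, [/\ open O, O (cmap c q), O `<=` cimg c,
    (forall x, O x -> smooth_at (cinv c x) f) & Csmooth O (f \o cinv c)].
Proof.
move=> [U [oU Uq sf]] cq; exists (cimg c `&` cinv c @^-1` U); split.
- exact: open_chart.
- by split; [exact: cmap_img|rewrite /= cmapK].
- exact: subIsetl.
- by move=> x [_ Ux]; exists U.
- exact: sf.
Qed.

Lemma smooth_at_differentiable f q : smooth_at q f -> cdom c q ->
  differentiable (f \o cinv c) (cmap c q).
Proof.
move=> sf cq; have [W [_ Wq _ _ sW]] := smooth_at_chart sf cq.
exact: Csmooth_differentiable Wq.
Qed.

(** The coordinate field d/dx_j of the chart, meaningful on [cdom c]. The value 0 on functions not
    smooth at q is the one [tg_out] demands. *)
Definition coord_vf (j : 'I_n) : M -> functional M := fun q f =>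
  if `[< smooth_at q f >]
  then 'D_(delta_mx 0 j) (f \o cinv c) (cmap c q) else 0.

Lemma coord_vfE j q f : smooth_at q f ->
  coord_vf j q f = 'D_(delta_mx 0 j) (f \o cinv c) (cmap c q).
Proof. by move=> sf; rewrite /coord_vf asboolT. Qed.

Lemma coord_vf_tangent j q : cdom c q -> tangent q (coord_vf j q).
Proof.
move=> cq; split.
- by move=> f nf; rewrite /coord_vf asboolF.
- move=> f g sf sg fg; rewrite !coord_vfE//; apply: near_eq_derive.
  have := cinv_cont (cmap_img cq).
  by rewrite /prop_for /continuous_at cmapK// => cc; exact: (cc _ fg).
- move=> d f g sf sg; rewrite !coord_vfE//; last exact: smooth_at_lin.
  have df := smooth_at_differentiable sf cq.
  have dg := smooth_at_differentiable sg cq.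
  rewrite [LHS](deriveD (f := d *: (f \o cinv c)) (g := g \o cinv c)).
  + by rewrite deriveZ//; exact: diff_derivable.
  + exact/diff_derivable/differentiableZ.
  + exact: diff_derivable.
- move=> f g sf sg; rewrite !coord_vfE//; last exact: smooth_at_mul.
  have df := smooth_at_differentiable sf cq.
  have dg := smooth_at_differentiable sg cq.
  rewrite [LHS](deriveM (f := f \o cinv c) (g := g \o cinv c)).
  + by rewrite /= (cmapK cq) addrC [_ *: _]mulrC.
  + exact: diff_derivable.
  + exact: diff_derivable.
Qed.

Lemma coord_vf_at j q : cdom c q -> vf_at q (coord_vf j).
Proof.
move=> cq; have oc := open_nbhs_nbhs (conj (@cdom_open _ _ _ c) cq).
apply: filterS oc => {cq} q cq; split; first exact: coord_vf_tangent.
move=> f sf; have [W [oW Wq Wc Wf sW]] := smooth_at_chart sf cq.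
have oN := open_cmap_preimage oW.
apply: (smooth_on_at oN) => //.
have sD := Csmooth_derive (delta_mx 0 j) sW.
apply: (smooth_on_ext oN) (smooth_on_chart oW sD) => r [cr Wr].
rewrite /vact coord_vfE//; rewrite -(cmapK cr); exact: Wf.
Qed.

Definition coord (j : 'I_n) : M -> R := fun q => cmap c q 0 j.

Lemma smooth_at_coord j q : cdom c q -> smooth_at q (coord j).
Proof.
move=> cq; apply: (smooth_on_at (@cdom_open _ _ _ c) cq) => c' ac'.
exact: atlas_compat.
Qed.

(** Hadamard writes f near q as f(q) + sum_j (x_j - x_j(q)) G_j. The derivation v kills the
    constant, and in the Leibniz rule only v(x_j) G_j(q) survives, because x_j - x_j(q) vanishes at
    q. *)
Lemma tangent_coord q v f : cdom c q -> tangent q v -> smooth_at q f ->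
  v f = \sum_(j < n) v (coord j) * coord_vf j q f.
Proof.
move=> cq tv sf; have [W [oW Wq Wc Wf sW]] := smooth_at_chart sf cq.
have /nbhs_ballP[r r0 rW] : nbhs (cmap c q) W by exact: open_nbhs_nbhs.
(* A ball is star-shaped about its centre, which [W] need not be. *)
pose x0 := cmap c q; pose B : set 'rV[R]_n := ball x0 r.
have oB : open B by exact: ball_open.
have Bx0 : B x0 by exact: ballxx.
have sB : Csmooth B (f \o cinv c) by move=> k; exact: Ck_sub (sW k).
have starB x (t : R) : B x -> 0 <= t <= 1 -> B (ray x0 x t).
  rewrite /B -ball_normE /= => Bx /andP[t0 t1]; apply: le_lt_trans Bx.
  rewrite /ray opprD addrA subrr add0r normrN normrZ ger0_norm// distrC.
  by rewrite ler_piMl.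
pose G j := radial_mean x0 0 ('D_(delta_mx 0 j) (f \o cinv c)).
have sG j : smooth_at q (G j \o cmap c).
  apply: (smooth_on_at (open_cmap_preimage oB)) => //.
  apply: smooth_on_chart => //; apply: Csmooth_radial_mean => //.
  exact: Csmooth_derive.
have sx j : smooth_at q (fun p => coord j p - x0 0 j).
  by apply: smooth_atB; [exact: smooth_at_coord|exact: smooth_at_cst].
have sxG j := smooth_at_mul (sx j) (sG j).
have nE : \forall p \near q, f p = 1 * f q +
    \sum_(j < n) (coord j p - x0 0 j) * (G j \o cmap c) p.
  have := open_nbhs_nbhs (conj (open_cmap_preimage oB) (conj cq Bx0)).
  apply: filterS => p [cp Bp].
  have := hadamard starB sB Bp; rewrite /= !cmapK// mul1r => ->.
  by congr (_ + _); apply: eq_bigr => j _; rewrite !mxE.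
have sS := smooth_at_sum sxG; have sc := smooth_at_cst q (f q).
rewrite (tg_local tv sf (smooth_at_lin 1 sc sS) nE) (tg_lin tv 1 sc sS).
rewrite (tangent_cst _ tv) mulr0 add0r (tangent_sum tv sxG).
apply: eq_bigr => j _; rewrite (tg_leibniz tv (sx j) (sG j)).
rewrite /coord subrr mul0r addr0 (tangentB tv)//; last 2 first.
- exact: smooth_at_coord.
- exact: smooth_at_cst.
rewrite (tangent_cst _ tv) subr0; congr (_ * _).
(* At the centre the segment degenerates, so G_j(q) is the partial derivative itself. *)
by rewrite coord_vfE// /= /G radial_mean_center.
Qed.

End coordinates.

(** Functions xi_j and fields E_j behaving like coordinates and their partial derivatives near p;
    from here on charts enter only through such a frame. *)
Lemma local_frame p :
  exists (xi : 'I_n -> M -> R) (E : 'I_n -> M -> functional M),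
  [/\ forall j, smooth_at p (xi j), forall j, vf_at p (E j) &
    \forall q \near p, forall v f, tangent q v -> smooth_at q f ->
      v f = \sum_(j < n) v (xi j) * E j q f].
Proof.
have [c ac cp] := atlas_cover p; exists (coord c), (coord_vf c); split.
- by move=> j; exact: smooth_at_coord.
- by move=> j; exact: coord_vf_at.
- apply: filterS (open_nbhs_nbhs (conj (@cdom_open _ _ _ c) cp)) => q cq v f.
  exact: tangent_coord.
Qed.

End frame.

(** * Vector fields *)

Section lie_calculus.
Context {R : realType} {n : nat} {M : manifold R n}.
Implicit Types (p q : M) (f g : M -> R) (U V : set M).
Implicit Types (X Y Z : M -> functional M) (a b : M -> functional M -> R^o).

Lemma vf_at_near p X : vf_at p X -> \forall q \near p, vf_at q X.
Proof. by move=> /near_join. Qed.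

Lemma vf_at_tangent p X : vf_at p X -> tangent p (X p).
Proof. by move=> /nbhs_singleton[]. Qed.

Lemma vf_at_vact p X f : vf_at p X -> smooth_at p f -> smooth_at p (vact X f).
Proof. by move=> /nbhs_singleton[_]; exact. Qed.

Lemma is_vfield_at U p X : open U -> U p -> is_vfield U X -> vf_at p X.
Proof.
move=> oU Up vX; apply: filterS (open_nbhs_nbhs (conj oU Up)) => q Uq.
by split=> [|f]; [exact: vf_tangent vX _ Uq|exact: smooth_at_vact vX].
Qed.

Lemma vf_at_is_vfield U X : (forall p, U p -> vf_at p X) ->
  (forall p, ~ U p -> X p = 0) -> is_vfield U X.
Proof.
move=> vX X0; split=> // [p /vX/vf_at_tangent//|V f oV VU sf].
apply: smooth_on_local => p Vp; apply: vf_at_vact; first exact/vX/VU.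
exact: smooth_on_at sf.
Qed.

Lemma vf_at_ext p X Y : (\forall q \near p, X q = Y q) ->
  vf_at p X -> vf_at p Y.
Proof.
move=> /near_join XY vX; near=> q; have [] // := near vX q.
have XYq : \forall r \near q, X r = Y r by near: q.
rewrite (nbhs_singleton XYq) => tY sX; split=> // f /sX.
by apply: smooth_at_ext; apply: filterS XYq => r Xr; rewrite /vact Xr.
Unshelve. all: by end_near. Qed.

Lemma vf_at_lin p c X Y : vf_at p X -> vf_at p Y -> vf_at p (c *: X + Y).
Proof.
apply: filterS2 => q [tX sX] [tY sY]; split; first exact: tangent_lin.
by move=> f sf; exact: smooth_at_lin (sX _ sf) (sY _ sf).
Qed.

Lemma vf_at0 p : vf_at p 0.
Proof.
by near=> q; split=> [|f _]; [exact: tangent0|exact: smooth_at_cst].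
Unshelve. all: by end_near. Qed.

Lemma vf_atB p X Y : vf_at p X -> vf_at p Y -> vf_at p (X - Y).
Proof.
by move=> vX vY; rewrite addrC -scaleN1r; exact: vf_at_lin.
Qed.

Lemma vf_at_sum p m (w : 'I_m -> R) (E : 'I_m -> M -> functional M) :
  (forall j, vf_at p (E j)) -> vf_at p (\sum_(j < m) w j *: E j).
Proof.
move=> vE; elim/big_ind : _ => //.
- exact: vf_at0.
- by move=> X Y vX vY; rewrite -[X]scale1r; exact: vf_at_lin.
- by move=> j _; rewrite -[_ *: _]addr0; apply: vf_at_lin => //; exact: vf_at0.
Qed.

Lemma tangent_near p X f g : vf_at p X -> smooth_at p f ->
  (\forall q \near p, f q = g q) -> X p f = X p g.
Proof.
move=> vX sf fg; apply: (tg_local (vf_at_tangent vX) sf) => //.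
exact: smooth_at_ext sf.
Qed.

Lemma vbracketE p X Y f : smooth_at p f ->
  vbracket X Y p f = X p (vact Y f) - Y p (vact X f).
Proof. by move=> sf; rewrite /vbracket asboolT. Qed.

Lemma vbracket_near p X Y X' Y' : vf_at p X -> vf_at p Y ->
  (\forall q \near p, X q = X' q) -> (\forall q \near p, Y q = Y' q) ->
  vbracket X Y p = vbracket X' Y' p.
Proof.
move=> vX vY XX YY; apply/funext => f; rewrite /vbracket.
case: asboolP => // sf; rewrite -(nbhs_singleton XX) -(nbhs_singleton YY).
congr (_ - _).
  apply: (tangent_near vX (vf_at_vact vY sf)).
  by apply: filterS YY => q Yq; rewrite /vact Yq.
apply: (tangent_near vY (vf_at_vact vX sf)).
by apply: filterS XX => q Xq; rewrite /vact Xq.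
Qed.

Lemma res_near {V : nmodType} U p (f : M -> V) : open U -> U p ->
  \forall q \near p, f q = res U f q.
Proof.
move=> oU Up; apply: filterS (open_nbhs_nbhs (conj oU Up)) => q Uq.
by rewrite /res patchT// inE.
Qed.

Lemma res_out {V : nmodType} U p (f : M -> V) : ~ U p -> res U f p = 0.
Proof. by move=> nUp; rewrite /res patchN// notin_setE. Qed.

Lemma resE {V : nmodType} U p (f : M -> V) : U p -> res U f p = f p.
Proof. by move=> Up; rewrite /res patchT// inE. Qed.

Lemma near_open p (P : M -> Prop) : (\forall q \near p, P q) ->
  exists U, [/\ open U, U p & forall q, U q -> P q].
Proof. by rewrite /prop_near1 nbhsE => -[U [oU Up] UP]; exists U. Qed.

Lemma is_vfield_res U X : open U -> (forall q, U q -> vf_at q X) ->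
  is_vfield U (res U X).
Proof.
move=> oU vX; apply: vf_at_is_vfield => [p Up|p]; last exact: res_out.
exact: vf_at_ext (res_near X oU Up) (vX _ Up).
Qed.

(** [tangent_vbracket] concerns fields on open sets, so [X] and [Y] are first cut off outside
    neighbourhoods where they are smooth; the bracket at q depends only on germs and does not
    change. *)
Lemma vf_at_bracket p X Y : vf_at p X -> vf_at p Y -> vf_at p (vbracket X Y).
Proof.
move=> /vf_at_near/near_open[U [oU Up vX]] /vf_at_near/near_open[V [oV Vp vY]].
have oW : open (U `&` V) by exact: openI.
apply: filterS (open_nbhs_nbhs (conj oW (conj Up Vp))) => q [Uq Vq].
split.
  rewrite (vbracket_near (vX q Uq) (vY q Vq)
    (res_near X oU Uq) (res_near Y oV Vq)).
  exact: tangent_vbracket oU Uq oV Vq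
    (is_vfield_res oU vX) (is_vfield_res oV vY).
move=> f sf; have sX g := vf_at_vact (f := g) (vX q Uq).
have sY g := vf_at_vact (f := g) (vY q Vq).
apply: smooth_at_ext (smooth_atB (sX _ (sY _ sf)) (sY _ (sX _ sf))).
apply: filterS (smooth_at_near sf) => r sfr.
by rewrite [RHS]vbracketE.
Qed.

Lemma vf_at_eq p X Y : vf_at p X -> vf_at p Y ->
  (forall f, smooth_at p f -> X p f = Y p f) -> X p = Y p.
Proof. by move=> vX vY; apply: tangent_eq; exact: vf_at_tangent. Qed.

Lemma vbracket_linr p X c Y Z : vf_at p X -> vf_at p Y -> vf_at p Z ->
  vbracket X (c *: Y + Z) p = c *: vbracket X Y p + vbracket X Z p.
Proof.
move=> vX vY vZ; apply/funext => f.
rewrite -[RHS]/(c * vbracket X Y p f + vbracket X Z p f) /vbracket.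
case: asboolP => sf; last by rewrite mulr0 addr0.
have -> : vact (c *: Y + Z) f = fun q => c * vact Y f q + vact Z f q by [].
rewrite (tg_lin (vf_at_tangent vX)); do ?exact: vf_at_vact.
rewrite -[(c *: Y + Z) p _]/(c * Y p (vact X f) + Z p (vact X f)); ring.
Qed.

Lemma vbracketC X Y : vbracket X Y = - vbracket Y X.
Proof.
apply/funext => p; apply/funext => f.
rewrite -[RHS]/(- vbracket Y X p f) /vbracket.
by case: asboolP => _; rewrite ?oppr0// opprB.
Qed.

Lemma vbracket_linl p X c Y Z : vf_at p X -> vf_at p Y -> vf_at p Z ->
  vbracket (c *: Y + Z) X p = c *: vbracket Y X p + vbracket Z X p.
Proof.
move=> vX vY vZ; rewrite vbracketC -[LHS]/(- vbracket X (c *: Y + Z) p).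
rewrite vbracket_linr// (vbracketC Y) (vbracketC Z).
rewrite -[(- vbracket X Y) p]/(- vbracket X Y p).
by rewrite -[(- vbracket X Z) p]/(- vbracket X Z p) scalerN opprD.
Qed.

(** On functions smooth near p the bracket acts as a commutator throughout a neighbourhood ([bE]).
    Both sides thus expand into triple compositions, which cancel formally. *)
Lemma vbracket_jacobi p X Y Z : vf_at p X -> vf_at p Y -> vf_at p Z ->
  vbracket X (vbracket Y Z) p =
  vbracket (vbracket X Y) Z p + vbracket Y (vbracket X Z) p.
Proof.
move=> vX vY vZ; apply/funext => f.
rewrite -[RHS]/(vbracket (vbracket X Y) Z p f + vbracket Y (vbracket X Z) p f).
have [sf|nf] := pselect (smooth_at p f); last first.
  by rewrite /vbracket asboolF// addr0.
have bE Y1 Z1 : vf_at p Y1 -> vf_at p Z1 ->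
    \forall q \near p, vact Y1 (vact Z1 f) q - vact Z1 (vact Y1 f) q =
                       vact (vbracket Y1 Z1) f q.
  move=> vY1 vZ1; apply: filterS (smooth_at_near sf) => q sfq.
  by rewrite [RHS]vbracketE.
have s2 Y1 Z1 : vf_at p Y1 -> vf_at p Z1 -> smooth_at p (vact Y1 (vact Z1 f)).
  by move=> vY1 vZ1; apply: vf_at_vact => //; exact: vf_at_vact.
have TE X1 Y1 Z1 : vf_at p X1 -> vf_at p Y1 -> vf_at p Z1 ->
    X1 p (vact (vbracket Y1 Z1) f) =
      X1 p (vact Y1 (vact Z1 f)) - X1 p (vact Z1 (vact Y1 f)).
  move=> vX1 vY1 vZ1; rewrite -(tangentB (vf_at_tangent vX1)); do ?exact: s2.
  by apply/esym/tangent_near => //; [apply: smooth_atB; exact: s2|exact: bE].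
rewrite !(vbracketE _ _ sf) !TE// !vbracketE; do ?exact: vf_at_vact.
rewrite /vact; ring.
Qed.

End lie_calculus.

(** * Differential forms *)

Section form_calculus.
Context {R : realType} {n : nat} {M : manifold R n}.
Implicit Types (p q : M) (f g : M -> R) (U V : set M).
Implicit Types (X Y Z D : M -> functional M) (v w : functional M).
Implicit Types (a b : M -> functional M -> R^o).

Definition pairing a X : M -> R := fun q => a q (X q).

Definition form_at p a : Prop := \forall q \near p,
  (forall c v w, tangent q v -> tangent q w ->
     a q (c *: v + w) = c * a q v + a q w) /\
  (forall X, vf_at q X -> smooth_at q (pairing a X)).

(** [form_at] says nothing about arguments that are not tangent vectors. This separate condition
    fixes the default there, so that forms can be equated as functions. *)
Definition null_off_tangent a : Prop := forall p v, ~ tangent p v -> a p v = 0.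

Lemma form_at_near p a : form_at p a -> \forall q \near p, form_at q a.
Proof. by move=> /near_join. Qed.

Lemma form_at_lin p a c v w : form_at p a -> tangent p v -> tangent p w ->
  a p (c *: v + w) = c * a p v + a p w.
Proof. by move=> /nbhs_singleton[+ _]; exact. Qed.

Lemma form_at_pairing p a X : form_at p a -> vf_at p X ->
  smooth_at p (pairing a X).
Proof. by move=> /nbhs_singleton[_]; exact. Qed.

Lemma form_at_zero p a : form_at p a -> a p 0 = 0.
Proof.
move=> fa; have := form_at_lin (-1) fa (tangent0 p) (tangent0 p).
by rewrite scaler0 addr0 mulN1r addNr.
Qed.

Lemma form_atB p a v w : form_at p a -> tangent p v -> tangent p w ->
  a p (v - w) = a p v - a p w.
Proof.
by move=> fa tv tw; rewrite addrC -scaleN1r (form_at_lin _ fa)// mulN1r addrC.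
Qed.

Lemma tangent_lsum p m (w : 'I_m -> R) (E : 'I_m -> functional M) :
  (forall j, tangent p (E j)) -> tangent p (\sum_(j < m) w j *: E j).
Proof.
move=> tE; elim/big_ind : _ => //; first exact: tangent0.
- by move=> v v' tv tv'; rewrite -[v]scale1r; exact: tangent_lin.
- move=> j _; rewrite -[_ *: _]addr0.
  by apply: tangent_lin => //; exact: tangent0.
Qed.

Lemma form_at_sum p a m (w : 'I_m -> R) (E : 'I_m -> functional M) :
  form_at p a -> (forall j, tangent p (E j)) ->
  a p (\sum_(j < m) w j *: E j) = \sum_(j < m) w j * a p (E j).
Proof.
move=> fa; elim: m w E => [|m IH] w E tE.
  by rewrite !big_ord0 form_at_zero.
rewrite !big_ord_recl (form_at_lin _ fa) ?IH//; exact: tangent_lsum.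
Qed.

Lemma form_at_ext p a b : (\forall q \near p, a q = b q) -> form_at p a ->
  form_at p b.
Proof.
move=> /near_join ab fa; near=> q; have [] // := near fa q.
have abq : \forall r \near q, a r = b r by near: q.
rewrite (nbhs_singleton abq) => la sa; split=> // X /sa.
by apply: smooth_at_ext; apply: filterS abq => r ar; rewrite /pairing ar.
Unshelve. all: by end_near. Qed.

(** [fm_smooth] tests fields on open subsets only, so a germ of a field is restricted to an open set
    where it is smooth before the test applies. *)
Lemma is_form_at U p a : open U -> U p -> is_form U a -> form_at p a.
Proof.
move=> oU Up fa; apply: filterS (open_nbhs_nbhs (conj oU Up)) => q Uq.
split=> [c v w tv tw|X]; first by rewrite (fm_lin fa).
move=> /vf_at_near/near_open[V [oV Vq vX]].
have oUV : open (U `&` V) by exact: openI.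
have sX : smooth_on (U `&` V) (fun r => a r (res (U `&` V) X r)).
  apply: (fm_smooth fa) => //.
  by apply: is_vfield_res => // r [_ /vX].
apply: smooth_at_ext (smooth_on_at oUV (conj Uq Vq) sX).
by apply: filterS (res_near X oUV (conj Uq Vq)) => r Xr; rewrite /pairing Xr.
Qed.

Lemma form_at_is_form U a : (forall p, U p -> form_at p a) ->
  null_off_tangent a -> (forall p, ~ U p -> a p = 0) -> is_form U a.
Proof.
move=> fa va a0; split=> //.
- by move=> p c v w /fa; exact: form_at_lin.
- move=> V X oV VU vX; apply: smooth_on_local => p Vp.
  by apply: form_at_pairing; [exact/fa/VU|exact: is_vfield_at vX].
Qed.

Lemma form_at_res U a : open U -> (forall p, U p -> form_at p a) ->
  null_off_tangent a -> is_form U (res U a).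
Proof.
move=> oU fa va; apply: form_at_is_form => [p Up|p v nt|p].
- exact: form_at_ext (res_near a oU Up) (fa _ Up).
- have [Up|nUp] := pselect (U p); first by rewrite resE// va.
  by rewrite res_out.
- exact: res_out.
Qed.

Lemma form_at_linear p c a b : form_at p a -> form_at p b ->
  form_at p (c *: a + b).
Proof.
have E q v : (c *: a + b) q v = c * a q v + b q v by [].
apply: filterS2 => q [la sa] [lb sb]; split=> [d v w tv tw|X vX].
  by rewrite !E la// lb//; ring.
exact: smooth_at_lin (sa _ vX) (sb _ vX).
Qed.

Lemma form_at_sub p a b : form_at p a -> form_at p b ->
  form_at p (a - b).
Proof. by move=> fa fb; rewrite addrC -scaleN1r; exact: form_at_linear. Qed.

Lemma functional_sumE m (w : 'I_m -> R) (E : 'I_m -> functional M) f :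
  (\sum_(j < m) w j *: E j) f = \sum_(j < m) w j * E j f.
Proof. by elim/big_rec2 : _ => // j r v _ <-. Qed.

Lemma vf_sumE m (w : 'I_m -> R) (E : 'I_m -> M -> functional M) p f :
  (\sum_(j < m) w j *: E j) p f = \sum_(j < m) w j * E j p f.
Proof. by elim/big_rec2 : _ => // j v X _ <-. Qed.

(** The combination of the frame with the constant coefficients v(xi_j) has value v at p, by the
    frame formula. *)
Lemma tangent_extension p v : tangent p v -> exists2 Y, vf_at p Y & Y p = v.
Proof.
move=> tv; have [xi [E [sxi vE /nbhs_singleton fr]]] := local_frame p.
pose w j : R := v (xi j).
have vS : vf_at p (\sum_(j < n) w j *: E j) by exact: vf_at_sum.
exists (\sum_(j < n) w j *: E j) => //.
apply: (tangent_eq (vf_at_tangent vS) tv) => f sf.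
by rewrite [RHS]fr// vf_sumE.
Qed.

(** Every tangent vector is the value of a field, so forms may be compared on fields, where [lieE]
    computes Lie derivatives. *)
Lemma form_eq p a b : null_off_tangent a -> null_off_tangent b ->
  (forall Y, vf_at p Y -> a p (Y p) = b p (Y p)) -> a p = b p.
Proof.
move=> va vb ab; apply/funext => v; have [tv|nt] := pselect (tangent p v).
  by have [Y vY <-] := tangent_extension tv; exact: ab.
by rewrite va// vb.
Qed.

(* Tensoriality: the difference X(a(Y)) - a([X, Y]) only depends on Y p. *)
Lemma pairing_vanishing p a X D : form_at p a -> vf_at p X -> vf_at p D ->
  D p = 0 -> X p (pairing a D) = a p (vbracket X D p).
Proof.
move=> fa vX vD D0; have [xi [E [sxi vE fr]]] := local_frame p.
have tX := vf_at_tangent vX.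
have sF j : smooth_at p (vact D (xi j)) by exact: vf_at_vact.
have F0 j : vact D (xi j) p = 0 by rewrite /vact D0.
(* The coefficients D(xi_j) vanish at p, so the Leibniz rule keeps only the terms that differentiate
   them. *)
have Dj (g : 'I_n -> M -> R) : (forall j, smooth_at p (g j)) ->
    X p (fun q => \sum_(j < n) vact D (xi j) q * g j q) =
    \sum_(j < n) X p (vact D (xi j)) * g j p.
  move=> sg; rewrite (tangent_sum tX) => [|j]; last exact: smooth_at_mul.
  by apply: eq_bigr => j _; rewrite (tg_leibniz tX)// F0 mul0r addr0.
have nvE : \forall q \near p, forall j, tangent q (E j q).
  by apply: filter_forall => j; apply: filterS (vE j) => q [].
(* Near p the field D is the sum of D(xi_j) E_j, and [a] is linear on tangent vectors. *)
have -> : X p (pairing a D) = \sum_(j < n) X p (vact D (xi j)) * a p (E j p).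
  rewrite -(Dj (fun j => pairing a (E j))) => [|j]; last exact: form_at_pairing.
  apply: tangent_near => //; first exact: form_at_pairing.
  near=> q; have tE : forall j, tangent q (E j q) by near: q.
  rewrite /pairing -form_at_sum//; last by near: q; exact: form_at_near.
  congr (a q _); have tD : tangent q (D q).
    by apply: vf_at_tangent; near: q; exact: vf_at_near.
  apply: (tangent_eq tD) => [|f sf]; first exact: tangent_lsum.
  by rewrite functional_sumE; apply: (near fr q).
rewrite -form_at_sum//; last by move=> j; exact: vf_at_tangent.
(* It remains to see that [X, D] at p is the sum of X(D(xi_j)) E_j: the term D(X f) is zero because
   D vanishes at p. *)
congr (a p _); apply: (@tangent_eq _ _ _ p) => [||f sf].
- by apply: tangent_lsum => j; exact: vf_at_tangent.
- exact/vf_at_tangent/vf_at_bracket.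
rewrite vbracketE// D0 -[(0 : functional M) _]/0 subr0 functional_sumE.
rewrite -(Dj (fun j => vact (E j) f)) => [|j]; last exact: vf_at_vact.
apply/esym/tangent_near => //; first exact: vf_at_vact.
near=> q; apply: (near fr q) => //.
  by apply: vf_at_tangent; near: q; exact: vf_at_near.
by near: q; exact: smooth_at_near.
Unshelve. all: by end_near. Qed.

Lemma lieE p a X Y : form_at p a -> vf_at p X -> vf_at p Y ->
  lie X a p (Y p) = X p (pairing a Y) - a p (vbracket X Y p).
Proof.
move=> fa vX vY; rewrite /lie asboolT; last exact: vf_at_tangent.
(* The default branch of the choice is impossible: [Y], restricted to an open set where it is
   smooth, is an extension. *)
rewrite /extension /=; case: xgetP => [Z _ [[W [oW Wp vfZ]] ZY]|nZ]; last first.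
  have [V [oV Vp vV]] := near_open (vf_at_near vY).
  exfalso; apply: (nZ (res V Y)); split; last by rewrite resE.
  by exists V; split=> //; exact: is_vfield_res.
have vZ := is_vfield_at oW Wp vfZ.
(* The chosen extension [Z] and the given [Y] agree at p, so tensoriality applies to their
   difference. *)
have := pairing_vanishing fa vX (vf_atB vZ vY).
rewrite -[(Z - Y) p]/(Z p - Y p) ZY subrr => /(_ erefl).
have -> : vbracket X (Z - Y) p = vbracket X Z p - vbracket X Y p.
  rewrite addrC -scaleN1r vbracket_linr// scaleN1r addrC//.
have tb X1 : vf_at p X1 -> tangent p (vbracket X X1 p).
  by move=> vX1; exact/vf_at_tangent/vf_at_bracket.
rewrite (form_atB fa); do ?exact: tb.
have -> : X p (pairing a (Z - Y)) = X p (pairing a Z) - X p (pairing a Y).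
  rewrite -(tangentB (vf_at_tangent vX)); do ?exact: form_at_pairing.
  apply: tangent_near => //.
    by apply: form_at_pairing => //; exact: vf_atB.
  near=> q; apply: form_atB.
  - by near: q; exact: form_at_near.
  - by apply: vf_at_tangent; near: q; exact: vf_at_near.
  - by apply: vf_at_tangent; near: q; exact: vf_at_near.
by move=> E; rewrite -/(pairing a Z); lra.
Unshelve. all: by end_near. Qed.

End form_calculus.

(** * The Lie derivative *)

Section lie_derivative.
Context {R : realType} {n : nat} {M : manifold R n}.
Implicit Types (p q : M) (f g : M -> R) (U V : set M).
Implicit Types (X Y Z : M -> functional M) (v w : functional M).
Implicit Types (a b : M -> functional M -> R^o).

Lemma lie_null_off X a : null_off_tangent (lie X a).
Proof. by move=> p v nt; rewrite /lie asboolF. Qed.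

Lemma dform_null_off f : null_off_tangent (dform f).
Proof. by move=> p v nt; rewrite /dform asboolF. Qed.

Lemma null_off_tangent_lin c a b :
  null_off_tangent a -> null_off_tangent b -> null_off_tangent (c *: a + b).
Proof.
move=> va vb p v nt; rewrite -[LHS]/(c * a p v + b p v) va// vb//.
by rewrite mulr0 addr0.
Qed.

Lemma null_off_tangentB a b :
  null_off_tangent a -> null_off_tangent b -> null_off_tangent (a - b).
Proof.
by move=> va vb; rewrite addrC -scaleN1r; exact: null_off_tangent_lin.
Qed.

Lemma dformE p f v : tangent p v -> dform f p v = v f.
Proof. by move=> tv; rewrite /dform asboolT. Qed.

Lemma dform_at p f : smooth_at p f -> form_at p (dform f).
Proof.
move=> /smooth_at_near; apply: filterS => q sf; split=> [c v w tv tw|X vX].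
  by rewrite !dformE//; exact: tangent_lin.
apply: smooth_at_ext (vf_at_vact vX sf).
apply: filterS (vf_at_near vX) => r vXr.
by rewrite /pairing dformE//; exact: vf_at_tangent.
Qed.

(** Linearity is checked after extending both vectors to fields; smoothness holds because X(a(Y))
    and a([X, Y]) are both smooth. *)
Lemma lie_at p X a : vf_at p X -> form_at p a -> form_at p (lie X a).
Proof.
move=> /vf_at_near vX /form_at_near fa; near=> q.
have vXq : vf_at q X by near: q.
have faq : form_at q a by near: q.
split=> [c v w|Y vY].
  move=> /tangent_extension[Y vY <-] /tangent_extension[Z vZ <-].
  rewrite -[c *: Y q + Z q]/((c *: Y + Z) q) !lieE//; last exact: vf_at_lin.
  rewrite vbracket_linr// (form_at_lin _ faq);
    do ?exact/vf_at_tangent/vf_at_bracket.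
  have -> : X q (pairing a (c *: Y + Z)) =
      c * X q (pairing a Y) + X q (pairing a Z).
    rewrite -(tg_lin (vf_at_tangent vXq)); do ?exact: form_at_pairing.
    apply: tangent_near => //.
      by apply: form_at_pairing => //; exact: vf_at_lin.
    near=> r; apply: form_at_lin.
    - by near: r; exact: form_at_near.
    - by apply: vf_at_tangent; near: r; exact: vf_at_near.
    - by apply: vf_at_tangent; near: r; exact: vf_at_near.
  ring.
have sXa := vf_at_vact vXq (form_at_pairing faq vY).
have sab := form_at_pairing faq (vf_at_bracket vXq vY).
apply: smooth_at_ext (smooth_atB sXa sab).
near=> r; rewrite /pairing lieE//.
- by near: r; exact: form_at_near.
- by near: r; exact: vf_at_near.
- by near: r; exact: vf_at_near.
Unshelve. all: by end_near. Qed.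

Lemma lie_pairing_near p X Y a : vf_at p X -> vf_at p Y -> form_at p a ->
  \forall q \near p, vact X (pairing a Y) q - pairing a (vbracket X Y) q =
                     pairing (lie X a) Y q.
Proof.
move=> /vf_at_near vX /vf_at_near vY /form_at_near fa; near=> q.
by rewrite [RHS]lieE//; near: q.
Unshelve. all: by end_near. Qed.

Lemma lie_near p X a b : vf_at p X -> form_at p a ->
  (\forall q \near p, a q = b q) -> lie X a p = lie X b p.
Proof.
move=> vX fa ab; have fb := form_at_ext ab fa.
apply: form_eq (@lie_null_off _ _) (@lie_null_off _ _) _ => Y vY.
rewrite !lieE// (nbhs_singleton ab); congr (_ - _).
apply: tangent_near => //; first exact: form_at_pairing.
by apply: filterS ab => q aq; rewrite /pairing aq.
Qed.

Lemma lie_linr p X c a b : vf_at p X -> form_at p a -> form_at p b ->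
  lie X (c *: a + b) p = c *: lie X a p + lie X b p.
Proof.
move=> vX fa fb; rewrite -[RHS]/((c *: lie X a + lie X b) p).
apply: form_eq => [||Y vY]; do ?exact: lie_null_off.
  by apply: null_off_tangent_lin; exact: lie_null_off.
rewrite -[RHS]/(c * lie X a p (Y p) + lie X b p (Y p)) !lieE//; last first.
  exact: form_at_linear.
have -> : pairing (c *: a + b) Y =
    fun q => c * pairing a Y q + pairing b Y q by [].
rewrite (tg_lin (vf_at_tangent vX)); do ?exact: form_at_pairing.
rewrite -[(c *: a + b) p _]/(c * a p _ + b p _); ring.
Qed.

Lemma lieBr p X a b : vf_at p X -> form_at p a -> form_at p b ->
  lie X (a - b) p = lie X a p - lie X b p.
Proof.
move=> vX fa fb; rewrite addrC -scaleN1r lie_linr//.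
by rewrite scaleN1r addrC.
Qed.

Lemma lie_linl p c X Y a : vf_at p X -> vf_at p Y -> form_at p a ->
  lie (c *: X + Y) a p = c *: lie X a p + lie Y a p.
Proof.
move=> vX vY fa; rewrite -[RHS]/((c *: lie X a + lie Y a) p).
apply: form_eq => [||Z vZ]; do ?exact: lie_null_off.
  by apply: null_off_tangent_lin; exact: lie_null_off.
rewrite -[RHS]/(c * lie X a p (Z p) + lie Y a p (Z p)) !lieE//; last first.
  exact: vf_at_lin.
rewrite vbracket_linl// (form_at_lin _ fa);
  do ?exact/vf_at_tangent/vf_at_bracket.
rewrite -[(c *: X + Y) p _]/(c * X p _ + Y p _); ring.
Qed.

(** Evaluated on Z, the terms X(Y(a(Z))) and Y(X(a(Z))) give the commutator, the terms X(a([Y, Z]))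
    and Y(a([X, Z])) cancel, and the rest is the Jacobi identity inside [a]. *)
Lemma lie_bracket p X Y a : vf_at p X -> vf_at p Y -> form_at p a ->
  lie (vbracket X Y) a p = lie X (lie Y a) p - lie Y (lie X a) p.
Proof.
move=> vX vY fa; rewrite -[RHS]/((lie X (lie Y a) - lie Y (lie X a)) p).
apply: form_eq => [||Z vZ]; do ?exact: lie_null_off.
  by apply: null_off_tangentB; exact: lie_null_off.
rewrite -[RHS]/(lie X (lie Y a) p (Z p) - lie Y (lie X a) p (Z p)).
have vXY := vf_at_bracket vX vY.
have vXZ := vf_at_bracket vX vZ; have vYZ := vf_at_bracket vY vZ.
have sP Z1 := form_at_pairing (X := Z1) fa.
have LE X1 Y1 : vf_at p X1 -> vf_at p Y1 -> X1 p (pairing (lie Y1 a) Z) =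
    X1 p (vact Y1 (pairing a Z)) - X1 p (pairing a (vbracket Y1 Z)).
  move=> vX1 vY1; have vb := vf_at_bracket vY1 vZ.
  have sV := vf_at_vact vY1 (sP _ vZ).
  rewrite -(tangentB (vf_at_tangent vX1) sV (sP _ vb)).
  apply/esym/tangent_near => //; first exact: smooth_atB sV (sP _ vb).
  exact: lie_pairing_near.
rewrite !lieE//; do ?exact: lie_at.
rewrite !LE// vbracketE; last exact: sP.
have vXYZ := vf_at_bracket vX vYZ; have vYXZ := vf_at_bracket vY vXZ.
have -> : a p (vbracket (vbracket X Y) Z p) =
    a p (vbracket X (vbracket Y Z) p) - a p (vbracket Y (vbracket X Z) p).
  rewrite -(form_atB fa); do ?exact: vf_at_tangent.
  by congr (a p _); rewrite vbracket_jacobi// addrK.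
lra.
Qed.

(** On a field Y this reads X(Y f) - [X, Y] f = Y(X f). *)
Lemma lie_dform p X f : vf_at p X -> smooth_at p f ->
  lie X (dform f) p = dform (vact X f) p.
Proof.
move=> vX sf; apply: form_eq => [||Y vY]; first exact: lie_null_off.
  exact: dform_null_off.
rewrite lieE//; last exact: dform_at.
have vb := vf_at_bracket vX vY.
rewrite !dformE; do ?exact: vf_at_tangent.
rewrite vbracketE//.
have -> : X p (pairing (dform f) Y) = X p (vact Y f).
  apply/esym/tangent_near => //; first exact: vf_at_vact.
  apply: filterS (vf_at_near vY) => q vYq.
  by rewrite /pairing dformE//; exact: vf_at_tangent.
lra.
Qed.

Lemma dformB p f g : smooth_at p f -> smooth_at p g ->
  dform (fun q => f q - g q) p = dform f p - dform g p.
Proof.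
move=> sf sg; rewrite addrC -scaleN1r -dform_lin//; apply/funext => v.
rewrite /dform; case: asboolP => // _; congr v; apply/funext => q.
by rewrite mulN1r addrC.
Qed.

Lemma dform_near p f g : smooth_at p f -> (\forall q \near p, f q = g q) ->
  dform f p = dform g p.
Proof.
move=> sf fg; apply/funext => v; rewrite /dform; case: asboolP => // tv.
exact: (tg_local tv sf (smooth_at_ext fg sf)).
Qed.

End lie_derivative.

(** * The logarithmic derivative *)

Section dlog_bracket.
Context {R : realType} {n : nat} {M : manifold R n}.
Local Open Scope complex_scope.
Implicit Types (p q : M) (G : M -> R[i]) (X Y : M -> functional M).

(** Clearing the denominator turns i r = dlog G (v) into v(G) = i r G, which splits into two real
    equations to which derivations apply. *)
Lemma dlogE G p (v : functional M) (r : R) : G p != 0 ->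
  r*i = dlog G p v <->
  v (fun q => complex.Re (G q)) = - (r * complex.Im (G p)) /\
  v (fun q => complex.Im (G q)) = r * complex.Re (G p).
Proof.
move=> G0; rewrite /dlog.
move: (v (fun q => complex.Re _)) (v (fun q => complex.Im _)) => s t.
have E : r*i = (G p)^-1 * (s +i* t) <-> G p * r*i = s +i* t.
  split=> [->|<-]; first by rewrite mulVKf.
  by rewrite mulKf.
apply: (iff_trans E); case: (G p) => a b /=; split=> [/eqP|[-> ->]].
  rewrite eq_complex /= !mulr0 sub0r addr0 mulrC (mulrC a).
  by move=> /andP[/eqP <- /eqP <-].
by apply/eqP; rewrite eq_complex /= !mulr0 sub0r addr0 mulrC (mulrC a) !eqxx.
Qed.

(** Closedness of dlog G. From X G = i r G and Y G = i s G one gets X(Y G) = i (X s) G - r s G; the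
    last term is symmetric in X and Y, so [X, Y] G = i (X s - Y r) G. *)
Lemma dlog_bracket G p X Y (r s : M -> R) : vf_at p X -> vf_at p Y ->
  smooth_at p (fun q => complex.Re (G q)) ->
  smooth_at p (fun q => complex.Im (G q)) ->
  (\forall q \near p, G q != 0) -> smooth_at p r -> smooth_at p s ->
  (\forall q \near p, (r q)*i = dlog G q (X q)) ->
  (\forall q \near p, (s q)*i = dlog G q (Y q)) ->
  (X p s - Y p r)*i = dlog G p (vbracket X Y p).
Proof.
move=> vX vY sRe sIm G0 sr ss Xr Ys.
have key X1 Y1 t : vf_at p X1 -> vf_at p Y1 -> smooth_at p t ->
    (\forall q \near p, (t q)*i = dlog G q (Y1 q)) ->
  X1 p (vact Y1 (fun q => complex.Re (G q))) =
    - (X1 p t * complex.Im (G p) + t p * X1 p (fun q => complex.Im (G q))) /\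
  X1 p (vact Y1 (fun q => complex.Im (G q))) =
    X1 p t * complex.Re (G p) + t p * X1 p (fun q => complex.Re (G q)).
  move=> vX1 vY1 st Yt; have tX1 := vf_at_tangent vX1.
  have YE : \forall q \near p,
      vact Y1 (fun q => complex.Re (G q)) q = - (t q * complex.Im (G q)) /\
      vact Y1 (fun q => complex.Im (G q)) q = t q * complex.Re (G q).
    by apply: filterS2 G0 Yt => q G0q Yq; apply/dlogE.
  rewrite -!(tg_leibniz tX1)//; split; last first.
    apply: tangent_near => //; first exact: vf_at_vact.
    by apply: filterS YE => q [].
  (* The sign is moved inside as a difference from the zero function, to match the local formula for
     Y1 applied to the real part. *)
  have -> : - X1 p (fun q => t q * complex.Im (G q)) =
      X1 p (fun q => (fun=> 0) q - t q * complex.Im (G q)).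
    rewrite (tangentB tX1); last 2 first.
    - exact: smooth_at_cst.
    - exact: smooth_at_mul.
    by rewrite (tangent_cst _ tX1) sub0r.
  apply: tangent_near => //; first exact: vf_at_vact.
  by apply: filterS YE => q [Yq _]; rewrite sub0r.
have G0p := nbhs_singleton G0.
have [XRe XIm] := (dlogE _ _ G0p).1 (nbhs_singleton Xr).
have [YRe YIm] := (dlogE _ _ G0p).1 (nbhs_singleton Ys).
have [XYRe XYIm] := key X Y s vX vY ss Ys.
have [YXRe YXIm] := key Y X r vY vX sr Xr.
apply/dlogE => //; rewrite !vbracketE// XYRe XYIm YXRe YXIm XRe XIm YRe YIm.
by split; ring.
Qed.

End dlog_bracket.

(** * The bracket on objects *)

Lemma subrBB (V : zmodType) (a b c d : V) : a - b - (c - d) = a - c - (b - d).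
Proof. by rewrite [- (c - d)]opprD [- (b - d)]opprD addrACA. Qed.

Section bracket.
Context {R : realType} {n : nat} {M : manifold R n} {I : Type}.
Context {U : open_cover M I} {g : cech2_cocycle U} {A : connection g}.
Implicit Types (x y z : ob A) (u w : cochain0 U) (i j k : I) (p q : M).
Local Open Scope complex_scope.

Lemma is_fun_at V (f : M -> R) p : open V -> V p -> Defs.is_fun V f ->
  smooth_at p f.
Proof. by move=> oV Vp [sf _]; exact: smooth_on_at sf. Qed.

Lemma is_fun_res V (f : M -> R) : open V -> (forall p, V p -> smooth_at p f) ->
  Defs.is_fun V (res V f).
Proof.
move=> oV sf; split=> [|p]; last exact: res_out.
apply: smooth_on_local => p Vp.
exact: smooth_at_ext (res_near f oV Vp) (sf _ Vp).
Qed.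

Lemma cov_near i p : U i p -> \forall q \near p, U i q.
Proof.
by move=> Ui; exact: (open_nbhs_nbhs (conj (@cov_open _ _ _ _ U i) Ui)).
Qed.

Lemma ob_vf_at x p : vf_at p (ob_vf x).
Proof. exact: is_vfield_at openT Logic.I (is_ob_vf (obP x)). Qed.

Lemma ob_f_at x i j p : U i p -> U j p -> smooth_at p (ob_f x i j).
Proof.
move=> Ui Uj; apply: (is_fun_at (openUU U i j) (conj Ui Uj)).
exact: is_ob_f (obP x) i j.
Qed.

Lemma ob_a_at x i p : U i p -> form_at p (ob_a x i).
Proof.
by move=> Ui; exact: is_form_at (@cov_open _ _ _ _ U i) Ui (is_ob_a (obP x) i).
Qed.

Lemma conn_at i j p : U i p -> U j p -> form_at p (conn A i j).
Proof.
move=> Ui Uj.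
exact: is_form_at (openUU U i j) (conj Ui Uj) (@conn_form _ _ _ _ _ _ A i j).
Qed.

Lemma c0_at u i p : U i p -> smooth_at p (u i).
Proof. by move=> Ui; exact: is_fun_at (@cov_open _ _ _ _ U i) Ui (c0P u i). Qed.

(** All components vanish outside their domains, and the vector fields are zero on non-smooth germs,
    so nothing needs checking there. *)
Lemma ob_ext x y :
  (forall p f, smooth_at p f -> ob_vf x p f = ob_vf y p f) ->
  (forall i j p, U i p -> U j p -> ob_f x i j p = ob_f y i j p) ->
  (forall i p, U i p -> ob_a x i p = ob_a y i p) -> x = y.
Proof.
move=> Evf Ef Ea; apply: ob_eq.
- by apply/funext => p; apply: vf_at_eq (Evf p); exact: ob_vf_at.
- apply/funext => i; apply/funext => j; apply/funext => p.
  have [[Ui Uj]|nU] := pselect ((U i `&` U j) p); first exact: Ef.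
  by rewrite (is_ob_f (obP x) i j).2// (is_ob_f (obP y) i j).2.
- apply/funext => i; apply/funext => p.
  have [Ui|nU] := pselect (U i p); first exact: Ea.
  by rewrite (fm_out (is_ob_a (obP x) i))// (fm_out (is_ob_a (obP y) i)).
Qed.

Lemma c0_ext u w : (forall i p, U i p -> u i p = w i p) -> u = w.
Proof.
move=> E; apply: c0_eq; apply/funext => i; apply/funext => p.
have [Ui|nU] := pselect (U i p); first exact: E.
by rewrite (c0P u i).2// (c0P w i).2.
Qed.

Definition diff_f u i j : M -> R^o :=
  res (U i `&` U j) (fun p => u j p - u i p).
Definition diff_a u i := res (U i) (dform (u i)).

Lemma diff_fE u i j p : U i p -> U j p -> diff_f u i j p = u j p - u i p.
Proof. by move=> Ui Uj; rewrite /diff_f resE. Qed.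

(** The Cech coboundary of u_j - u_i telescopes to 0, matching the zero vector field, and d commutes
    with differences. *)
Lemma is_ob_diff u : is_ob A 0 (diff_f u) (diff_a u).
Proof.
split.
- exact: is_vfield0.
- move=> i j; apply: is_fun_res => [|p [Ui Uj]]; first exact: openUU.
  by apply: smooth_atB; exact: c0_at.
- move=> i; apply: form_at_res => [|p Ui|]; first exact: cov_open.
    exact/dform_at/c0_at.
  exact: dform_null_off.
- move=> i j k p Ui Uj Uk; rewrite !diff_fE// /dlog.
  rewrite -[(0 : M -> functional M) p _]/(0 : R).
  rewrite -[(0 : M -> functional M) p _]/(0 : R).
  have -> : u k p - u j p - (u k p - u i p) + (u j p - u i p) = 0 by ring.
  by rewrite mulr0.
- move=> i j p Ui Uj; rewrite /diff_a !resE//.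
  have sB : smooth_at p (fun q => u j q - u i q).
    by apply: smooth_atB; exact: c0_at.
  rewrite -(dform_near sB (res_near _ (openUU U i j) (conj Ui Uj))).
  rewrite dformB; do ?exact: c0_at.
  (* Linearity at -1 * 0 + 0 shows that the Lie derivative along the zero field vanishes. *)
  have := lie_linl (-1) (vf_at0 p) (vf_at0 p) (conn_at Ui Uj).
  by rewrite scaler0 addr0 scaleN1r addNr => ->; rewrite subr0.
Qed.

Definition diff_ob u : ob A := Ob (is_ob_diff u).

Definition br_f x y i j : M -> R^o := res (U i `&` U j)
  (fun p => vact (ob_vf x) (ob_f y i j) p - vact (ob_vf y) (ob_f x i j) p).
Definition br_a x y i := res (U i)
  (fun p => lie (ob_vf x) (ob_a y i) p - lie (ob_vf y) (ob_a x i) p).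

Lemma br_fE x y i j p : U i p -> U j p -> br_f x y i j p =
  ob_vf x p (ob_f y i j) - ob_vf y p (ob_f x i j).
Proof. by move=> Ui Uj; rewrite /br_f resE. Qed.

Lemma br_aE x y i p : U i p -> br_a x y i p =
  lie (ob_vf x) (ob_a y i) p - lie (ob_vf y) (ob_a x i) p.
Proof. by move=> Ui; rewrite /br_a resE. Qed.

Lemma vact_ob_f_at x y i j p : U i p -> U j p ->
  smooth_at p (vact (ob_vf x) (ob_f y i j)).
Proof. by move=> Ui Uj; apply: vf_at_vact (ob_vf_at x p) _; exact: ob_f_at. Qed.

Lemma lie_ob_at x y i p : U i p -> form_at p (lie (ob_vf x) (ob_a y i)).
Proof. by move=> Ui; apply: lie_at; [exact: ob_vf_at|exact: ob_a_at]. Qed.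

(** The Lie derivative along x of the relation a_j - a_i = df_ij - L_y A_ij for y, with L_x moved
    past d. *)
Lemma lie_ob_aE x y i j p : U i p -> U j p ->
  lie (ob_vf x) (ob_a y j) p - lie (ob_vf x) (ob_a y i) p =
  dform (vact (ob_vf x) (ob_f y i j)) p -
  lie (ob_vf x) (lie (ob_vf y) (conn A i j)) p.
Proof.
move=> Ui Uj; have vx := ob_vf_at x p; have vy := ob_vf_at y p.
have sf := ob_f_at y Ui Uj; have fA := conn_at Ui Uj.
rewrite -lie_dform//.
rewrite -!lieBr//; do ?exact: ob_a_at; do ?exact: lie_at; do ?exact: dform_at.
apply: lie_near => //; first by apply: form_at_sub; exact: ob_a_at.
apply: filterS2 (cov_near Ui) (cov_near Uj) => q Uiq Ujq.
exact: (is_ob_aE (obP y)).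
Qed.

Lemma is_ob_br x y :
  is_ob A (vbracket (ob_vf x) (ob_vf y)) (br_f x y) (br_a x y).
Proof.
have vx p := ob_vf_at x p; have vy p := ob_vf_at y p.
split.
- apply: vf_at_is_vfield => [p _|p nT]; first exact: vf_at_bracket.
  by exfalso; exact: nT.
- move=> i j; apply: is_fun_res => [|p [Ui Uj]]; first exact: openUU.
  by apply: smooth_atB; exact: vact_ob_f_at.
- move=> i; apply: form_at_res => [|p Ui|]; first exact: cov_open.
    by apply: form_at_sub; exact: lie_ob_at.
  by apply: null_off_tangentB; exact: lie_null_off.
- move=> i j k p Ui Uj Uk; rewrite !br_fE//.
  have nU : \forall q \near p, [/\ U i q, U j q & U k q].
    by apply: filterS3 (cov_near Ui) (cov_near Uj) (cov_near Uk).
  (* The Cech coboundary of the functions of z, which equals dlog g evaluated on its field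
     throughout a neighbourhood; closedness of dlog g then gives the condition for the bracket. *)
  pose r z q := ob_f z j k q - ob_f z i k q + ob_f z i j q.
  have sr z : smooth_at p (fun q => ob_f z j k q - ob_f z i k q).
    by apply: smooth_atB; exact: ob_f_at.
  have rE z q : r z q = 1 * (ob_f z j k q - ob_f z i k q) + ob_f z i j q.
    by rewrite mul1r.
  have sR z : smooth_at p (r z).
    rewrite (funext (rE z)); apply: smooth_at_lin => //; exact: ob_f_at.
  have rX z : \forall q \near p, (r z q)*i = dlog (g i j k) q (ob_vf z q).
    by apply: filterS nU => q [? ? ?]; exact: (is_ob_fE (obP z)).
  have vr z1 z2 : ob_vf z1 p (r z2) = ob_vf z1 p (ob_f z2 j k) -
      ob_vf z1 p (ob_f z2 i k) + ob_vf z1 p (ob_f z2 i j).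
    have tz := vf_at_tangent (ob_vf_at z1 p).
    rewrite (funext (rE z2)) (tg_lin tz)//; last exact: ob_f_at.
    by rewrite mul1r (tangentB tz)//; exact: ob_f_at.
  rewrite -(dlog_bracket (vx p) (vy p) _ _ _ (sR x) (sR y) (rX x) (rX y)).
  + by rewrite !vr; congr (_ *i); ring.
  + apply: (smooth_on_at (openI (openUU U i j) (@cov_open _ _ _ _ U k))) => //.
    exact: (coc_smooth g i j k).1.
  + apply: (smooth_on_at (openI (openUU U i j) (@cov_open _ _ _ _ U k))) => //.
    exact: (coc_smooth g i j k).2.
  + apply: filterS nU => q [Uiq Ujq Ukq].
    by rewrite -normr_eq0 coc_circle// oner_eq0.
- move=> i j p Ui Uj; rewrite !br_aE//.
  have sB : smooth_at p (fun q =>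
      vact (ob_vf x) (ob_f y i j) q - vact (ob_vf y) (ob_f x i j) q).
    by apply: smooth_atB; exact: vact_ob_f_at.
  rewrite -(dform_near sB (res_near _ (openUU U i j) (conj Ui Uj))).
  rewrite dformB; do ?exact: vact_ob_f_at.
  rewrite lie_bracket//; last exact: conn_at.
  (* Antisymmetrizing this relation in x and y produces [L_x, L_y] A_ij, which is the Lie derivative
     along the bracket. *)
  have xy := lie_ob_aE x y Ui Uj; have yx := lie_ob_aE y x Ui Uj.
  by rewrite subrBB xy yx subrBB.
Qed.

Definition br_ob x y : ob A := Ob (is_ob_br x y).

Lemma is_c0_act x u i : Defs.is_fun (U i) (res (U i) (vact (ob_vf x) (u i))).
Proof.
apply: is_fun_res => [|p Ui]; first exact: cov_open.
by apply: vf_at_vact (ob_vf_at x p) _; exact: c0_at.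
Qed.

Definition act_c0 x u : cochain0 U := Cochain0 (is_c0_act x u).

Lemma act_c0E x u i p : U i p -> act_c0 x u i p = ob_vf x p (u i).
Proof. by move=> Ui; rewrite /= resE. Qed.

End bracket.

(** * The identities of a 2-term L_oo-algebra *)

Section identities.
Context {R : realType} {n : nat} {M : manifold R n} {I : Type}.
Context {U : open_cover M I} {g : cech2_cocycle U} {A : connection g}.
Implicit Types (x y z : ob A) (u w : cochain0 U) (i j k : I) (p q : M).

Lemma diff_lin : linear (diff_ob : cochain0 U -> ob A).
Proof.
move=> c u w; apply: ob_ext => [p f _|i j p Ui Uj|i p Ui].
- by rewrite -[RHS]/(c * 0 + 0 : R) mulr0 addr0.
- rewrite -[RHS]/(c * diff_f u i j p + diff_f w i j p) /= !diff_fE//.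
  rewrite -[(c *: u + w) j p]/(c * u j p + w j p).
  rewrite -[(c *: u + w) i p]/(c * u i p + w i p); ring.
- rewrite -[RHS]/(c *: diff_a u i p + diff_a w i p) /= /diff_a !resE//.
  by rewrite -dform_lin//; exact: c0_at.
Qed.

Lemma act_linr x : linear (act_c0 x).
Proof.
move=> c u w; apply: c0_ext => i p Ui.
rewrite -[RHS]/(c * act_c0 x u i p + act_c0 x w i p) !act_c0E//.
by rewrite -(tg_lin (vf_at_tangent (ob_vf_at x p)))//; exact: c0_at.
Qed.

Lemma act_linl u : linear (act_c0 ^~ u : ob A -> cochain0 U).
Proof.
move=> c x y; apply: c0_ext => i p Ui.
by rewrite -[RHS]/(c * act_c0 x u i p + act_c0 y u i p) !act_c0E.
Qed.

Lemma act0 x : act_c0 x 0 = 0.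
Proof.
by have := act_linr x (-1) 0 0; rewrite scaler0 addr0 scaleN1r addNr.
Qed.

Lemma actN x u : act_c0 x (- u) = - act_c0 x u.
Proof.
by have := act_linr x (-1) u 0; rewrite !addr0 act0 addr0 !scaleN1r.
Qed.

(** Removes the restriction [res] under a derivative: on the open set it does not change the germ at
    p. [vf_br_f] and [lie_br_a] do the same for the bracket. *)
Lemma vf_act_c0 (X : M -> functional M) x u i p : vf_at p X -> U i p ->
  X p (act_c0 x u i) = X p (vact (ob_vf x) (u i)).
Proof.
move=> vX Ui; apply/esym/tangent_near => //.
  by apply: vf_at_vact (ob_vf_at x p) _; exact: c0_at.
exact: res_near (@cov_open _ _ _ _ U i) Ui.
Qed.

Lemma act_br x y u :
  act_c0 (br_ob x y) u = act_c0 x (act_c0 y u) - act_c0 y (act_c0 x u).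
Proof.
apply: c0_ext => i p Ui.
rewrite -[RHS]/(act_c0 x (act_c0 y u) i p - act_c0 y (act_c0 x u) i p).
rewrite !act_c0E// (vf_act_c0 y u (ob_vf_at x p) Ui).
by rewrite (vf_act_c0 x u (ob_vf_at y p) Ui); exact: vbracketE (c0_at u Ui).
Qed.

Lemma act_diff u w : act_c0 (diff_ob u : ob A) w = 0.
Proof. by apply: c0_ext => i p Ui; rewrite act_c0E. Qed.

Lemma br_anti x y : br_ob x y = - br_ob y x.
Proof.
apply: ob_ext => [p f sf|i j p Ui Uj|i p Ui].
- by rewrite /= vbracketC.
- by rewrite -[RHS]/(- br_f y x i j p) /= !br_fE// opprB.
- by rewrite -[RHS]/(- br_a y x i p) /= !br_aE// opprB.
Qed.

Lemma br_linr x : linear (br_ob x).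
Proof.
move=> c y z; have vx p := ob_vf_at x p.
have vy p := ob_vf_at y p; have vz p := ob_vf_at z p.
apply: ob_ext => [p f sf|i j p Ui Uj|i p Ui].
- by rewrite /= vbracket_linr.
- rewrite -[RHS]/(c * br_f x y i j p + br_f x z i j p) /= !br_fE//.
  rewrite -[X in X - _]/(ob_vf x p (fun q => c * ob_f y i j q + ob_f z i j q)).
  rewrite (tg_lin (vf_at_tangent (vx p))); do ?exact: ob_f_at.
  rewrite -[X in _ - X]/(c * ob_vf y p (ob_f x i j) + ob_vf z p (ob_f x i j)).
  ring.
- rewrite -[RHS]/(c *: br_a x y i p + br_a x z i p) /= !br_aE//.
  rewrite -[ob_a (c *: y + z) i]/(c *: ob_a y i + ob_a z i).
  rewrite -[ob_vf (c *: y + z)]/(c *: ob_vf y + ob_vf z).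
  rewrite lie_linr// ?lie_linl//; do ?exact: ob_a_at.
  by rewrite scalerBr opprD addrACA.
Qed.

Lemma br_linl y : linear (br_ob ^~ y : ob A -> ob A).
Proof.
move=> c x z; rewrite br_anti br_linr (br_anti x) (br_anti z).
by rewrite opprD scalerN.
Qed.

(** Since [diff_ob u] has zero vector field, only the terms differentiated along x survive; they
    match by additivity of the derivation and by L_X d = d L_X. *)
Lemma act_chain x u : diff_ob (act_c0 x u) = br_ob x (diff_ob u).
Proof.
apply: ob_ext => [p f sf|i j p Ui Uj|i p Ui].
- rewrite /= vbracketE// /vact /= subr0.
  by rewrite (tangent_cst _ (vf_at_tangent (ob_vf_at x p))).
- rewrite /= diff_fE// br_fE// !act_c0E//.
  rewrite -[X in _ = _ - X]/(0 : R) subr0.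
  rewrite -(tangentB (vf_at_tangent (ob_vf_at x p))); do ?exact: c0_at.
  apply: tangent_near; first exact: ob_vf_at.
    by apply: smooth_atB; exact: c0_at.
  exact: res_near (openUU U i j) (conj Ui Uj).
- rewrite /= /diff_a resE// br_aE//=.
  have := lie_linl (-1) (vf_at0 p) (vf_at0 p) (ob_a_at x Ui).
  rewrite scaler0 addr0 scaleN1r addNr => ->; rewrite subr0.
  have su := c0_at u Ui; have vx := ob_vf_at x p.
  have oUi := @cov_open _ _ _ _ U i.
  rewrite -(lie_near vx (dform_at su) (res_near _ oUi Ui)) lie_dform//.
  by apply/esym/dform_near; [exact: vf_at_vact|exact: res_near].
Qed.

Lemma vf_br_f (X : M -> functional M) x y i j p : vf_at p X -> U i p -> U j p ->
  X p (br_f x y i j) =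
  X p (vact (ob_vf x) (ob_f y i j)) - X p (vact (ob_vf y) (ob_f x i j)).
Proof.
move=> vX Ui Uj; have sxy x1 y1 := vact_ob_f_at x1 y1 Ui Uj.
rewrite -(tangentB (vf_at_tangent vX))//; apply/esym/tangent_near => //.
  exact: smooth_atB.
exact: res_near (openUU U i j) (conj Ui Uj).
Qed.

Lemma lie_br_a (X : M -> functional M) x y i p : vf_at p X -> U i p ->
  lie X (br_a x y i) p =
  lie X (lie (ob_vf x) (ob_a y i)) p - lie X (lie (ob_vf y) (ob_a x i)) p.
Proof.
move=> vX Ui; have fxy x1 y1 := lie_ob_at x1 y1 Ui.
rewrite -lieBr//; apply/esym/lie_near => //; first exact: form_at_sub.
exact: res_near (@cov_open _ _ _ _ U i) Ui.
Qed.

(** The three components reduce to the Jacobi identity for fields, to [X, Y] acting as a commutator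
    on functions, and to L_[X,Y] = [L_X, L_Y] on forms; what is left cancels formally. *)
Lemma br_jacobi x y z :
  br_ob x (br_ob y z) = br_ob (br_ob x y) z + br_ob y (br_ob x z).
Proof.
have v x1 p := ob_vf_at x1 p.
apply: ob_ext => [p f sf|i j p Ui Uj|i p Ui].
- by rewrite /= vbracket_jacobi.
- have sf x1 := ob_f_at x1 Ui Uj.
  rewrite -[RHS]/(br_f (br_ob x y) z i j p + br_f y (br_ob x z) i j p) /=.
  rewrite !br_fE//= !vf_br_f// !vbracketE//; ring.
- have fa x1 := ob_a_at x1 Ui.
  rewrite -[RHS]/(br_a (br_ob x y) z i p + br_a y (br_ob x z) i p) /=.
  rewrite !br_aE//= !lie_br_a// !lie_bracket//; apply/funext => v1.
  rewrite !fctE; ring.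
Qed.

End identities.

(** * Assembly of the algebra with J = 0 *)

Unset Implicit Arguments.

Theorem proposition10p48 (R : realType) (n : nat) (M : manifold R n)
    (I : Type) (U : open_cover M I) (g : cech2_cocycle U) (A : connection g) :
  exists L : linfty2 (cochain0 U) (ob A),
    [/\ (forall u : cochain0 U,
           [/\ ob_vf (l_d L u) = 0,
               (forall i j, ob_f (l_d L u) i j =
                  res (U i `&` U j) (fun p => u j p - u i p)) &
               (forall i, ob_a (l_d L u) i = res (U i) (dform (u i)))]),
        (forall x y : ob A,
           [/\ ob_vf (l_br L x y) = vbracket (ob_vf x) (ob_vf y),
               (forall i j, ob_f (l_br L x y) i j =
                  res (U i `&` U j) (fun p =>
                    vact (ob_vf x) (ob_f y i j) p -
                    vact (ob_vf y) (ob_f x i j) p)) &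
               (forall i, ob_a (l_br L x y) i =
                  res (U i) (fun p =>
                    lie (ob_vf x) (ob_a y i) p - lie (ob_vf y) (ob_a x i) p))]),
        (forall (x : ob A) (u : cochain0 U),
           (forall i, l_brl L x u i = res (U i) (vact (ob_vf x) (u i))) /\
           l_brl L x u = - l_brr L u x) &
        (forall x y z : ob A, l_J L x y z = 0)].
Proof.
pose brr (u : cochain0 U) (x : ob A) : cochain0 U := - act_c0 x u.
have brr_linl x : linear (brr ^~ x).
  by move=> c u w; rewrite /brr act_linr opprD scalerN.
have brr_linr u : linear (brr u).
  by move=> c x y; rewrite /brr act_linl opprD scalerN.
have lin0 (V W : lmodType R) : linear (fun _ : V => 0 : W).
  by move=> c x y; rewrite scaler0 addr0.
have diff0 : diff_ob 0 = 0 :> ob A.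
  have := @diff_lin _ _ _ _ _ _ A (-1) 0 0.
  by rewrite scaler0 addr0 scaleN1r addNr.
have brr_anti (x : ob A) u : act_c0 x u = - brr u x by rewrite /brr opprK.
(* Both sides are zero, because exact objects have zero vector field. *)
have chain2 u w : act_c0 (diff_ob u : ob A) w = brr u (diff_ob w).
  by rewrite /brr !act_diff oppr0.
have anti0 : (0 : cochain0 U) = - 0 by rewrite oppr0.
(* With J = 0 the homotopy conditions say that the bracket satisfies the Jacobi identity
   strictly. *)
have J000 (x y z : ob A) : diff_ob (0 : cochain0 U) =
    br_ob (br_ob x y) z + br_ob y (br_ob x z) - br_ob x (br_ob y z).
  by rewrite diff0 (br_jacobi x y z) subrr.
(* This condition and the next two all rearrange [act_br], the fact that objects act on functions
   through commutators. *)
have J100 u (y z : ob A) : (0 : cochain0 U) =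
    brr (brr u y) z + act_c0 y (brr u z) - brr u (br_ob y z).
  by rewrite /brr !actN act_br !opprK addrA subrK subrr.
have J010 (x : ob A) u (z : ob A) : (0 : cochain0 U) =
    brr (act_c0 x u) z + brr u (br_ob x z) - act_c0 x (brr u z).
  by rewrite /brr !actN act_br !opprK opprB addrA addNr add0r addNr.
have J001 (x y : ob A) u : (0 : cochain0 U) =
    act_c0 (br_ob x y) u + act_c0 y (act_c0 x u) - act_c0 x (act_c0 y u).
  by rewrite act_br subrK subrr.
have coh (x y z w : ob A) : act_c0 x (0 : cochain0 U) + 0 + 0 + brr 0 w +
    act_c0 z 0 = 0 + 0 + act_c0 y 0 + 0 + 0.
  by rewrite /brr !act0 oppr0 !addr0.
exists (@Linfty2 R _ _ diff_ob br_ob act_c0 brr (fun _ _ _ => 0)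
  diff_lin br_linl br_linr act_linl act_linr brr_linl brr_linr
  (fun _ _ => @lin0 _ _) (fun _ _ => @lin0 _ _) (fun _ _ => @lin0 _ _)
  br_anti brr_anti act_chain chain2 (fun _ _ _ => anti0) (fun _ _ _ => anti0)
  J000 J100 J010 J001 coh).
by split=> [u|x y|x u|x y z] //; split=> //; exact: brr_anti.
Qed.
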